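(* Let $G$ be a nontrivial torsion-free compact abelian group. Then every nonempty subset of $\widehat{G}$ is ubiquitous, but no finite subset of $\widehat{G}$ is strictly positive definite.
   Context: A trigonometric polynomial on $\widehat{G}$ is a function of the form $\gamma \mapsto \sum_{i=1}^n c_i \gamma(x_i)$ with $x_i \in G$, $c_i \in \mathbb{C}$. A subset $K \subset \widehat{G}$ is strictly positive definite if the only trigonometric polynomial on $\widehat{G}$ vanishing at every point of $K$ is the identically zero function. A subset $K \subset \widehat{G}$ is ubiquitous if for every subgroup $H$ of $\widehat{G}$ of finite index and every $\gamma \in \widehat{G}$ the coset $\gamma H$ meets $K$. *)

(* Defs.v *)
From Stdlib Require Import Reals List.
Import ListNotations.
Open Scope R_scope.

Definition C : Type := (R * R)%type.
Definition C0 : C := (0, 0).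
Definition C1 : C := (1, 0).
Definition Cadd (z w : C) : C := (fst z + fst w, snd z + snd w).
Definition Cmul (z w : C) : C :=
  (fst z * fst w - snd z * snd w, fst z * snd w + snd z * fst w).
Definition Cnorm2 (z : C) : R := fst z * fst z + snd z * snd z.
Definition Cdist2 (z w : C) : R := Cnorm2 (fst z - fst w, snd z - snd w).

Record TopAbGroup := mkTopAbGroup {
  tg_car :> Type;
  tg_add : tg_car -> tg_car -> tg_car;
  tg_opp : tg_car -> tg_car;
  tg_zero : tg_car;
  tg_open : (tg_car -> Prop) -> Prop
}.

Section Defs.
Variable G : TopAbGroup.
Local Notation "x + y" := (tg_add G x y).
Local Notation "- x" := (tg_opp G x).
Local Notation "0" := (tg_zero G).
Local Notation opn := (tg_open G).

Definition is_abelian_group : Prop :=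
  (forall x y z : G, x + (y + z) = (x + y) + z) /\
  (forall x y : G, x + y = y + x) /\
  (forall x : G, x + 0 = x) /\
  (forall x : G, x + (- x) = 0).

Definition is_topology : Prop :=
  opn (fun _ => True) /\ opn (fun _ => False) /\
  (forall U V, opn U -> opn V -> opn (fun x => U x /\ V x)) /\
  (forall (I : Type) (U : I -> G -> Prop),
      (forall i, opn (U i)) -> opn (fun x => exists i, U i x)).

Definition sub_continuous : Prop :=
  forall (x y : G) (W : G -> Prop), opn W -> W (x + - y) ->
  exists U V, opn U /\ opn V /\ U x /\ V y /\
    (forall u v, U u -> V v -> W (u + - v)).

Definition hausdorff : Prop :=
  forall x y : G, x <> y -> exists U V, opn U /\ opn V /\ U x /\ V y /\
    (forall z, U z -> V z -> False).

Definition compact : Prop :=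
  forall (I : Type) (U : I -> G -> Prop),
    (forall i, opn (U i)) -> (forall x, exists i, U i x) ->
    exists l : list I, forall x, exists i, In i l /\ U i x.

Definition is_compact_abelian_group : Prop :=
  is_abelian_group /\ is_topology /\ sub_continuous /\ hausdorff /\ compact.

Fixpoint nsmul (n : nat) (x : G) : G :=
  match n with O => 0 | S m => x + nsmul m x end.

Definition torsion_free : Prop :=
  forall (n : nat) (x : G), (0 < n)%nat -> nsmul n x = 0 -> x = 0.

Definition nontrivial : Prop := exists x : G, x <> 0.

Definition continuous_to_C (f : G -> C) : Prop :=
  forall (x : G) (eps : R), 0 < eps ->
  exists U, opn U /\ U x /\ forall y, U y -> Cdist2 (f y) (f x) < eps.

Definition is_character (g : G -> C) : Prop :=
  (forall x, Cnorm2 (g x) = 1) /\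
  (forall x y, g (x + y) = Cmul (g x) (g y)) /\
  continuous_to_C g.

Definition dual : Type := { g : G -> C | is_character g }.

Definition dual_mul_rel (a b c : dual) : Prop :=
  forall x, proj1_sig c x = Cmul (proj1_sig a x) (proj1_sig b x).

Definition dual_is_one (a : dual) : Prop := forall x, proj1_sig a x = C1.

Definition dual_inv_rel (a b : dual) : Prop :=
  forall c, dual_mul_rel a b c -> dual_is_one c.

Definition is_subgroup (H : dual -> Prop) : Prop :=
  (forall e, dual_is_one e -> H e) /\
  (forall a b c, H a -> H b -> dual_mul_rel a b c -> H c) /\
  (forall a b, H a -> dual_inv_rel a b -> H b).

Definition finite_index (H : dual -> Prop) : Prop :=
  exists l : list dual, forall gam,
    exists g h, In g l /\ H h /\ dual_mul_rel g h gam.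

Definition coset_meets (gam : dual) (H K : dual -> Prop) : Prop :=
  exists h c, H h /\ dual_mul_rel gam h c /\ K c.

Definition ubiquitous (K : dual -> Prop) : Prop :=
  forall H : dual -> Prop, is_subgroup H -> finite_index H ->
  forall gam : dual, coset_meets gam H K.

(** trigonometric polynomial gam |-> sum_i c_i gam(x_i), given by [(c_i,x_i)] *)
Definition trig_eval (p : list (C * G)) (gam : dual) : C :=
  fold_right (fun cx acc => Cadd (Cmul (fst cx) (proj1_sig gam (snd cx))) acc) C0 p.

Definition strictly_positive_definite (K : dual -> Prop) : Prop :=
  forall p : list (C * G),
    (forall gam, K gam -> trig_eval p gam = C0) ->
    forall gam, trig_eval p gam = C0.

Definition finite_subset (K : dual -> Prop) : Prop :=
  exists l : list dual, forall gam, K gam -> In gam l.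

End Defs.

(* Main.v *)
Require Import Defs.
From Stdlib Require Import Reals List.
From Stdlib Require Import Lra Lia Factorial Wf_nat Classical ClassicalEpsilon.
From Stdlib Require Import FunctionalExtensionality ProofIrrelevance.
From Coquelicot Require Import Coquelicot.
Import ListNotations.
Open Scope R_scope.

(** Characters are found in the convolution algebra of the uniformly continuous functions on a
    precompact abelian group. The mean of a function is the constant that is uniformly
    approximated by averages of its translates. For a hermitian [phi <> 0] the squared norms of
    the powers of [phi] are log-convex and submultiplicative; this makes the powers of
    [phi * phi], suitably normalised, converge uniformly to a hermitian idempotent. A nonzero
    hermitian idempotent has squared norm at least [1], so there are minimal ones. Every function below a
    minimal idempotent, in particular each of its translates, is a scalar multiple of it: up to
    normalisation it is a character. It follows that a function [g <> 0] satisfies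
    [g * chi <> 0] for some character [chi]. For a difference of two translates of a bump function this
    shows that characters separate points; for [h x = mean_y (g (x + phi y) * conj (gam y))],
    with [phi] an embedding and [g] a bump function, it extends the character [gam] along [phi].

    If [G] is compact and torsion-free, multiplication by [n > 0] is an embedding, so the dual
    group is divisible and has no proper subgroup of finite index. For a finite set [l] of
    characters and [x <> 0], [prod_(g in l) (gam x - g x)] is a trigonometric polynomial in
    [gam] that vanishes on [l]. If it vanished everywhere, the proper subgroup [gam x = 1] would
    have finite index. *)

(** * Real and complex numbers *)

Lemma lub_approx (E : R -> Prop) t eps : is_lub E t -> 0 < eps -> exists s, E s /\ t - eps < s.
Proof.
  intros [_ Ht] He. apply NNPP. intros Hn.
  assert (t <= t - eps); [|lra]. apply Ht. intros s Hs.
  apply Rnot_lt_le. intros Hlt. apply Hn. now exists s.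
Qed.

Lemma sq_le_of_scaled_am_gm x a b : 0 <= x -> 0 <= a -> 0 <= b ->
  (forall t, 0 < t -> 2 * x <= t * a + b / t) -> x ^ 2 <= a * b.
Proof.
  intros [Hx| <-] Ha Hb H; [|nra]. apply le_epsilon. intros eps He.
  set (d := eps / (a + 1)). assert (Hd : 0 < d) by (apply Rdiv_lt_0_compat; lra).
  specialize (H ((b + d) / x) ltac:(apply Rdiv_lt_0_compat; lra)).
  assert (Hbd : b / ((b + d) / x) <= x).
  { replace (b / ((b + d) / x)) with (x * (b / (b + d))) by (field; lra).
    rewrite <- (Rmult_1_r x) at 2. apply Rmult_le_compat_l; [lra|]. apply Rle_div_l; lra. }
  assert (Hxx : x <= (b + d) / x * a) by lra.
  apply (Rmult_le_compat_r x) in Hxx; [|lra].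
  replace ((b + d) / x * a * x) with (a * b + d * a) in Hxx by (field; lra).
  assert (d * a <= eps).
  { replace eps with (d * (a + 1)) by (unfold d; field; lra). apply Rmult_le_compat_l; lra. }
  nra.
Qed.

Lemma half_pow_gt0 n : 0 < (/ 2) ^ n.
Proof. apply pow_lt. lra. Qed.

Lemma half_pow_decr n m : (n <= m)%nat -> (/ 2) ^ m <= (/ 2) ^ n.
Proof.
  intros Hnm. induction Hnm as [|m Hnm IH]; [apply Rle_refl|].
  simpl. pose proof (half_pow_gt0 m). lra.
Qed.

Lemma Cmod_minus_triangle (z w u : C) : Cmod (z - u) <= Cmod (z - w) + Cmod (w - u).
Proof. replace (z - u)%C with ((z - w) + (w - u))%C by ring. apply Cmod_triangle. Qed.

Lemma Cmod_minus_sym (z w : C) : Cmod (z - w) = Cmod (w - z).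
Proof. rewrite <- Cmod_opp. f_equal. ring. Qed.

Lemma Re_dist_le (z w : C) : Rabs (Re z - Re w) <= Cmod (z - w).
Proof.
  replace (Re z - Re w) with (Re (z - w)%C) by (unfold Cminus; now rewrite re_plus, re_opp).
  apply re_le_Cmod.
Qed.

Lemma Cconj_RtoC (r : R) : Cconj r = r.
Proof. apply injective_projections; simpl; ring. Qed.

Lemma RtoC_neq0 (r : R) : r <> 0 -> RtoC r <> 0%C.
Proof. intros Hr H. now apply Hr, RtoC_inj. Qed.

Lemma Cconj_fixed_real (z : C) : Cconj z = z -> RtoC (Re z) = z.
Proof.
  intros H. apply (f_equal snd) in H. simpl in H.
  apply injective_projections; simpl; [reflexivity|lra].
Qed.

Lemma Cmult_reg_r (z w u : C) : u <> 0%C -> (z * u = w * u)%C -> z = w.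
Proof.
  intros Hu H. replace z with (z * u / u)%C by (field; exact Hu). rewrite H. field. exact Hu.
Qed.

Lemma Cnorm2_Cmod (z : C) : Cnorm2 z = Cmod z ^ 2.
Proof. rewrite Cmod2_alt. unfold Cnorm2, Re, Im. ring. Qed.

Lemma Cdist2_Cmod (z w : C) : Cdist2 z w = Cmod (z - w) ^ 2.
Proof. apply (Cnorm2_Cmod (z - w)%C). Qed.

(** * Abelian groups *)

Declare Scope group_scope.
Delimit Scope group_scope with G.
Notation "x ⊕ y" := (tg_add _ x y) (at level 50, left associativity) : group_scope.
Notation "⊖ x" := (tg_opp _ x) (at level 35, right associativity) : group_scope.
Notation "x ⊖ y" := (tg_add _ x (tg_opp _ y)) (at level 50, left associativity) : group_scope.
Notation "𝟎" := (tg_zero _) : group_scope.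
Open Scope group_scope.

Existing Class is_abelian_group.

Section AbelianGroup.
Context {G : TopAbGroup} {HG : is_abelian_group G}.
Implicit Types x y z : G.

Lemma tg_add_assoc x y z : x ⊕ (y ⊕ z) = x ⊕ y ⊕ z.
Proof. apply HG. Qed.

Lemma tg_add_comm x y : x ⊕ y = y ⊕ x.
Proof. apply HG. Qed.

Lemma tg_add_zero_r x : x ⊕ 𝟎 = x.
Proof. apply HG. Qed.

Lemma tg_add_opp_r x : x ⊖ x = 𝟎.
Proof. apply HG. Qed.

Lemma tg_add_zero_l x : 𝟎 ⊕ x = x.
Proof. now rewrite tg_add_comm, tg_add_zero_r. Qed.

Lemma tg_add_left_comm x y z : x ⊕ (y ⊕ z) = y ⊕ (x ⊕ z).
Proof. now rewrite !tg_add_assoc, (tg_add_comm x y). Qed.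

Lemma tg_opp_add_cancel x y : ⊖ x ⊕ (x ⊕ y) = y.
Proof. now rewrite tg_add_assoc, (tg_add_comm (⊖ x)), tg_add_opp_r, tg_add_zero_l. Qed.

Lemma tg_opp_unique x y : x ⊕ y = 𝟎 -> y = ⊖ x.
Proof. intros H. now rewrite <- (tg_opp_add_cancel x y), H, tg_add_zero_r. Qed.

Lemma tg_opp_opp x : ⊖ ⊖ x = x.
Proof. symmetry. apply tg_opp_unique. now rewrite tg_add_comm, tg_add_opp_r. Qed.

Lemma tg_opp_zero : ⊖ 𝟎 = 𝟎 :> G.
Proof. symmetry. apply tg_opp_unique, tg_add_zero_r. Qed.

Lemma tg_opp_add x y : ⊖ (x ⊕ y) = ⊖ x ⊖ y.
Proof.
  symmetry. apply tg_opp_unique.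
  now rewrite <- tg_add_assoc, (tg_add_left_comm y), tg_add_opp_r, tg_add_zero_r, tg_add_opp_r.
Qed.

Lemma tg_sub_eq_zero x y : x ⊖ y = 𝟎 -> x = y.
Proof. intros H. rewrite <- (tg_opp_opp y). apply tg_opp_unique. now rewrite tg_add_comm. Qed.
End AbelianGroup.

Ltac move_to_front t :=
  repeat match goal with
  | |- context [tg_add _ ?y (tg_add _ t ?z)] =>
      tryif constr_eq y t then fail else rewrite (tg_add_left_comm y t z)
  | |- context [tg_add _ ?y t] => tryif constr_eq y t then fail else rewrite (tg_add_comm y t)
  end.

(* To prove [a = b], flatten [a - b] to a sum of terms [x] and [- x]; then bring opposite terms to
   the front and cancel them until nothing is left. *)
Ltac abelian :=
  apply tg_sub_eq_zero;
  rewrite ?tg_opp_add, ?tg_opp_opp, ?tg_opp_zero, <- ?tg_add_assoc, ?tg_add_zero_l, ?tg_add_zero_r;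
  repeat match goal with
  | |- context [tg_opp _ ?x] =>
      move_to_front x; move_to_front (tg_opp _ x); rewrite tg_opp_add_cancel
  end;
  rewrite ?(tg_add_comm (tg_opp _ _)), ?tg_add_opp_r; reflexivity.

Section AbelianGroupConsequences.
Context {G : TopAbGroup} {HG : is_abelian_group G}.

Lemma tg_add_idem (x : G) : x ⊕ x = x -> x = 𝟎.
Proof. intros H. transitivity (x ⊕ x ⊖ x); [|rewrite H]; abelian. Qed.

Lemma tg_add_sub_cancel (x y : G) : x ⊕ (y ⊖ x) = y.
Proof. abelian. Qed.
End AbelianGroupConsequences.

(** * Precompact groups *)

Definition nbhs0 (G : TopAbGroup) (V : G -> Prop) : Prop :=
  exists U, tg_open G U /\ U 𝟎 /\ forall x, U x -> V x.

Class TopologicalGroup (G : TopAbGroup) : Prop := {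
  topological_group_abelian :: is_abelian_group G;
  topological_group_topology : is_topology G;
  topological_group_sub : sub_continuous G
}.

Definition precompact (G : TopAbGroup) : Prop :=
  forall V, nbhs0 G V -> exists L : list G, forall x, exists a, In a L /\ V (x ⊖ a).

Class PrecompactGroup (G : TopAbGroup) : Prop := {
  precompact_group_topological :: TopologicalGroup G;
  precompact_group_precompact : precompact G
}.

Lemma Filter_forall_list {T A : Type} (F : (T -> Prop) -> Prop) {FF : Filter F}
  (L : list A) (P : A -> T -> Prop) :
  (forall a, In a L -> F (P a)) -> F (fun t => forall a, In a L -> P a t).
Proof.
  induction L as [|a L IH]; intros HP.
  - apply filter_imp with (2 := filter_true). intros t _ b [].
  - refine (filter_imp _ _ _ (filter_and _ _ (HP a _) (IH _))).
    + intros t [Ha HL] b [<-|Hb]; auto.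
    + now left.
    + intros b Hb. apply HP. now right.
Qed.

Section Neighborhoods.
Context {G : TopAbGroup} {HG : TopologicalGroup G}.

#[export] Instance nbhs0_filter : Filter (nbhs0 G).
Proof.
  destruct (topological_group_topology) as (HT & _ & HI & _). split.
  - now exists (fun _ => True).
  - intros P Q (U & HU & U0 & HP) (V & HV & V0 & HQ).
    exists (fun x => U x /\ V x). repeat split; auto; [apply HP|apply HQ]; tauto.
  - intros P Q HPQ (U & HU & U0 & HP). exists U. auto.
Qed.

Lemma nbhs0_zero V : nbhs0 G V -> V 𝟎.
Proof. intros (U & _ & U0 & H). auto. Qed.

Lemma nbhs0_sub V : nbhs0 G V -> exists W, nbhs0 G W /\ forall u v, W u -> W v -> V (u ⊖ v).
Proof.
  intros (U & HU & U0 & HV).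
  destruct (topological_group_sub 𝟎 𝟎 U HU) as (A & B & HA & HB & A0 & B0 & HAB).
  { now replace (𝟎 ⊖ 𝟎) with (tg_zero G) by abelian. }
  exists (fun x => A x /\ B x). split.
  - apply filter_and; [exists A|exists B]; auto.
  - intros u v [Hu _] [_ Hv]. auto.
Qed.

Lemma nbhs0_opp V : nbhs0 G V -> nbhs0 G (fun x => V (⊖ x)).
Proof.
  intros HV. destruct (nbhs0_sub V HV) as (W & HW & HWV).
  apply filter_imp with (2 := HW). intros x Hx.
  replace (⊖ x) with (𝟎 ⊖ x) by abelian. apply HWV; [now apply nbhs0_zero|exact Hx].
Qed.

Lemma nbhs0_add V : nbhs0 G V -> exists W, nbhs0 G W /\ forall u v, W u -> W v -> V (u ⊕ v).
Proof.
  intros HV. destruct (nbhs0_sub V HV) as (W & HW & HWV).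
  exists (fun x => W x /\ W (⊖ x)). split; [now apply filter_and, nbhs0_opp|].
  intros u v [Hu _] [_ Hv]. replace (u ⊕ v) with (u ⊖ ⊖ v) by abelian. auto.
Qed.

Lemma open_translate V x : nbhs0 G V ->
  exists U, tg_open G U /\ U x /\ forall y, U y -> V (y ⊖ x).
Proof.
  intros (W & HW & W0 & HV).
  destruct (topological_group_sub x x W HW) as (A & B & HA & _ & Ax & Bx & HAB).
  { now replace (x ⊖ x) with (tg_zero G) by abelian. }
  exists A. auto.
Qed.
End Neighborhoods.

Lemma nbhs0_cover {G : TopAbGroup} {HG : PrecompactGroup G} V : nbhs0 G V ->
  exists L : list G, L <> [] /\ forall x, exists a, In a L /\ V (x ⊖ a).
Proof.
  intros HV. destruct (precompact_group_precompact V HV) as (L & HL). exists L. split; [|exact HL].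
  intros ->. now destruct (HL 𝟎) as (a & [] & _).
Qed.

Definition prod_group (X Y : TopAbGroup) : TopAbGroup := {|
  tg_car := X * Y;
  tg_add p q := (fst p ⊕ fst q, snd p ⊕ snd q);
  tg_opp p := (⊖ fst p, ⊖ snd p);
  tg_zero := (𝟎, 𝟎);
  tg_open W := forall p, W p -> exists U V, tg_open X U /\ tg_open Y V /\
    U (fst p) /\ V (snd p) /\ forall x y, U x -> V y -> W (x, y)
|}.

Section ProductGroup.
Context {X Y : TopAbGroup} {HX : TopologicalGroup X} {HY : TopologicalGroup Y}.

Lemma nbhs0_prod (W : prod_group X Y -> Prop) :
  nbhs0 (prod_group X Y) W <-> filter_prod (nbhs0 X) (nbhs0 Y) W.
Proof.
  split.
  - intros (O & HO & O0 & HW). destruct (HO _ O0) as (U & V & HU & HV & U0 & V0 & HUV).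
    exists U V; [now exists U|now exists V|auto].
  - intros [P Q (U & HU & U0 & HP) (V & HV & V0 & HQ) HW].
    exists (fun p => U (fst p) /\ V (snd p)). split; [|split; [now split|]].
    + intros p [Hp Hq]. exists U, V. auto 6.
    + intros [x y] [Hx Hy]. auto.
Qed.

Lemma prod_is_abelian_group : is_abelian_group (prod_group X Y).
Proof.
  repeat split; intros; repeat match goal with p : tg_car (prod_group X Y) |- _ => destruct p end;
    simpl; f_equal; abelian.
Qed.

Lemma prod_is_topology : is_topology (prod_group X Y).
Proof.
  destruct (topological_group_topology (G := X)) as (TX & _ & IX & _).
  destruct (topological_group_topology (G := Y)) as (TY & _ & IY & _).
  split; [|split; [|split]].
  - intros p _. exists (fun _ => True), (fun _ => True). auto 6.
  - intros p [].
  - intros W W' HW HW' p [Hp Hp'].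
    destruct (HW p Hp) as (U & V & HU & HV & Up & Vp & HUV).
    destruct (HW' p Hp') as (U' & V' & HU' & HV' & Up' & Vp' & HUV').
    exists (fun x => U x /\ U' x), (fun y => V y /\ V' y).
    repeat split; auto; [apply HUV|apply HUV']; tauto.
  - intros I W HW p [i Hi]. destruct (HW i p Hi) as (U & V & HU & HV & Up & Vp & HUV).
    exists U, V. repeat split; auto. intros x y Hx Hy. exists i. auto.
Qed.

Lemma prod_sub_continuous : sub_continuous (prod_group X Y).
Proof.
  intros [x y] [x' y'] W HW Hxy.
  destruct (HW _ Hxy) as (U & V & HU & HV & Up & Vp & HUV). simpl in Up, Vp.
  destruct (topological_group_sub x x' U HU Up) as (A & A' & HA & HA' & Ax & Ax' & HAU).
  destruct (topological_group_sub y y' V HV Vp) as (B & B' & HB & HB' & By & By' & HBV).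
  exists (fun p => A (fst p) /\ B (snd p)), (fun p => A' (fst p) /\ B' (snd p)).
  split; [|split; [|split; [now split|split; [now split|]]]].
  - intros p []. exists A, B. auto 6.
  - intros p []. exists A', B'. auto 6.
  - intros u v [] []. apply HUV; [now apply HAU|now apply HBV].
Qed.

#[export] Instance prod_topological_group : TopologicalGroup (prod_group X Y).
Proof.
  exact (Build_TopologicalGroup _ prod_is_abelian_group prod_is_topology prod_sub_continuous).
Qed.
End ProductGroup.

#[export] Instance prod_precompact_group {X Y : TopAbGroup}
  {HX : PrecompactGroup X} {HY : PrecompactGroup Y} : PrecompactGroup (prod_group X Y).
Proof.
  split; [exact prod_topological_group|].
  intros W HW. apply nbhs0_prod in HW as [U V HU HV HW].
  destruct (precompact_group_precompact U HU) as (L & HL).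
  destruct (precompact_group_precompact V HV) as (L' & HL').
  exists (list_prod L L'). intros [x y].
  destruct (HL x) as (a & Ha & Hxa). destruct (HL' y) as (b & Hb & Hyb).
  exists (a, b). split; [now apply in_prod|now apply HW].
Qed.

(** * Uniformly continuous functions *)

Definition ucont (G : TopAbGroup) (f : G -> C) : Prop :=
  forall eps, 0 < eps -> nbhs0 G (fun d => forall x, Cmod (f (x ⊕ d) - f x) < eps).

Definition ucont_map (X Y : TopAbGroup) (phi : X -> Y) : Prop :=
  forall V, nbhs0 Y V -> nbhs0 X (fun d => forall x, V (phi (x ⊕ d) ⊖ phi x)).

Section UniformContinuity.
Context {G : TopAbGroup} {HG : TopologicalGroup G}.
Implicit Types f g : G -> C.

Lemma ucont_const c : ucont G (fun _ => c).
Proof.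
  intros eps He. apply filter_forall. intros d x.
  replace (c - c)%C with (RtoC 0) by ring. now rewrite Cmod_0.
Qed.

Lemma ucont_plus f g : ucont G f -> ucont G g -> ucont G (fun x => f x + g x)%C.
Proof.
  intros Hf Hg eps He.
  generalize (Hf (eps / 2) ltac:(lra)) (Hg (eps / 2) ltac:(lra)).
  intros Vf Vg. generalize (filter_and _ _ Vf Vg). apply filter_imp. intros d [Hdf Hdg] x.
  replace (_ - _)%C with ((f (x ⊕ d) - f x) + (g (x ⊕ d) - g x))%C by ring.
  apply Rle_lt_trans with (1 := Cmod_triangle _ _). specialize (Hdf x). specialize (Hdg x). lra.
Qed.

Lemma ucont_conj f : ucont G f -> ucont G (fun x => Cconj (f x)).
Proof.
  intros Hf eps He. apply filter_imp with (2 := Hf eps He). intros d Hd x.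
  rewrite <- Cminus_conj, Cmod_conj. apply Hd.
Qed.

Lemma ucont_limit f :
  (forall eps, 0 < eps -> exists g, ucont G g /\ forall x, Cmod (g x - f x) <= eps) -> ucont G f.
Proof.
  intros Hf eps He. destruct (Hf (eps / 3)) as (g & Hg & Hgf); [lra|].
  generalize (Hg (eps / 3) ltac:(lra)). apply filter_imp. intros d Hd x.
  pose proof (Hgf x) as Hx. pose proof (Hgf (x ⊕ d)) as Hxd. rewrite Cmod_minus_sym in Hxd.
  specialize (Hd x).
  apply Rle_lt_trans with (1 := Cmod_minus_triangle _ (g (x ⊕ d)) _).
  pose proof (Cmod_minus_triangle (g (x ⊕ d)) (g x) (f x)). lra.
Qed.
End UniformContinuity.

Section UniformContinuityPrecompact.
Context {G : TopAbGroup} {HG : PrecompactGroup G}.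
Implicit Types f g : G -> C.

Lemma ucont_bounded f : ucont G f -> exists B, 0 <= B /\ forall x, Cmod (f x) <= B.
Proof.
  intros Hf. destruct (nbhs0_cover _ (Hf 1 Rlt_0_1)) as (L & _ & HL).
  assert (HB : exists B, 0 <= B /\ forall a, In a L -> Cmod (f a) <= B).
  { clear HL. induction L as [|a L (B & HB0 & HB)].
    - exists 0. split; [lra|intros ? []].
    - exists (Rmax (Cmod (f a)) B). split; [apply Rle_trans with (1 := HB0), Rmax_r|].
      intros b [<-|Hb]; [apply Rmax_l|]. apply Rle_trans with B; [now apply HB|apply Rmax_r]. }
  destruct HB as (B & HB0 & HB). exists (B + 1). split; [lra|]. intros x.
  destruct (HL x) as (a & Ha & Hx). specialize (Hx a). specialize (HB a Ha).
  replace (a ⊕ (x ⊖ a)) with x in Hx by abelian.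
  replace (f x) with ((f x - f a) + f a)%C by ring.
  apply Rle_trans with (1 := Cmod_triangle _ _). lra.
Qed.

Lemma ucont_mult f g : ucont G f -> ucont G g -> ucont G (fun x => f x * g x)%C.
Proof.
  intros Hf Hg eps He.
  destruct (ucont_bounded f Hf) as (A & HA0 & HA). destruct (ucont_bounded g Hg) as (B & HB0 & HB).
  assert (Hd : 0 < eps / (A + B + 1)) by (apply Rdiv_lt_0_compat; lra).
  generalize (filter_and _ _ (Hf _ Hd) (Hg _ Hd)). apply filter_imp. intros d [Hdf Hdg] x.
  replace (_ - _)%C
    with ((f (x ⊕ d) - f x) * g (x ⊕ d) + f x * (g (x ⊕ d) - g x))%C by ring.
  apply Rle_lt_trans with (eps / (A + B + 1) * B + A * (eps / (A + B + 1))).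
  - apply Rle_trans with (1 := Cmod_triangle _ _). rewrite !Cmod_mult.
    apply Rplus_le_compat; apply Rmult_le_compat; auto using Cmod_ge_0, Rlt_le.
  - replace eps with (eps / (A + B + 1) * (A + B + 1)) at 3 by (field; lra). nra.
Qed.

Lemma ucont_scal c f : ucont G f -> ucont G (fun x => c * f x)%C.
Proof. apply ucont_mult, ucont_const. Qed.
End UniformContinuityPrecompact.

Section UniformlyContinuousMaps.
Context {X Y : TopAbGroup} {HX : TopologicalGroup X} {HY : TopologicalGroup Y}.

Lemma ucont_comp (f : Y -> C) (phi : X -> Y) :
  ucont Y f -> ucont_map X Y phi -> ucont X (fun x => f (phi x)).
Proof.
  intros Hf Hphi eps He. generalize (Hphi _ (Hf eps He)). apply filter_imp. intros d Hd x.
  specialize (Hd x (phi x)).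
  now replace (phi x ⊕ (phi (x ⊕ d) ⊖ phi x)) with (phi (x ⊕ d)) in Hd by abelian.
Qed.

Lemma affine_ucont_map (phi psi : X -> Y) :
  (forall x d, phi (x ⊕ d) ⊖ phi x = psi d) ->
  (forall V, nbhs0 Y V -> nbhs0 X (fun d => V (psi d))) -> ucont_map X Y phi.
Proof.
  intros Hphi Hpsi V HV. generalize (Hpsi V HV). apply filter_imp.
  intros d Hd x. now rewrite Hphi.
Qed.
End UniformlyContinuousMaps.

Section Shifts.
Context {G : TopAbGroup} {HG : TopologicalGroup G}.
Variable f : G -> C.
Hypothesis Hf : ucont G f.

Lemma ucont_shift a : ucont G (fun x => f (x ⊕ a)).
Proof.
  apply (ucont_comp f (fun x => x ⊕ a) Hf), (affine_ucont_map _ (fun d => d)); [|auto].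
  intros x d. abelian.
Qed.

Lemma ucont_reflect a : ucont G (fun x => f (a ⊖ x)).
Proof.
  apply (ucont_comp f (fun x => a ⊖ x) Hf), (affine_ucont_map _ (fun d => ⊖ d)).
  - intros x d. abelian.
  - apply nbhs0_opp.
Qed.

Lemma ucont_opp : ucont G (fun x => f (⊖ x)).
Proof.
  apply (ucont_comp f (fun x => ⊖ x) Hf), (affine_ucont_map _ (fun d => ⊖ d)).
  - intros x d. abelian.
  - apply nbhs0_opp.
Qed.
End Shifts.

Definition jointly_ucont (X Y : TopAbGroup) (F : X -> Y -> C) : Prop :=
  ucont (prod_group X Y) (fun p => F (fst p) (snd p)).

Section JointContinuity.
Context {X Y : TopAbGroup} {HX : TopologicalGroup X} {HY : TopologicalGroup Y}.

Lemma jointly_ucont_row F x : jointly_ucont X Y F -> ucont Y (F x).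
Proof.
  intros HF.
  apply (ucont_comp (X := Y) (Y := prod_group X Y) _ (fun y => (x, y)) HF).
  apply (affine_ucont_map (Y := prod_group X Y) _ (fun d => (𝟎, d))).
  - intros y d. simpl. f_equal; abelian.
  - intros W HW. apply nbhs0_prod in HW as [U V HU HV HW].
    generalize HV. apply filter_imp. intros d Hd. apply HW; [now apply nbhs0_zero|exact Hd].
Qed.

Lemma jointly_ucont_fst f : ucont X f -> jointly_ucont X Y (fun x _ => f x).
Proof.
  intros Hf. apply (ucont_comp (X := prod_group X Y) f fst Hf).
  apply (affine_ucont_map (X := prod_group X Y) _ fst).
  - intros [x y] [d e]. simpl. abelian.
  - intros V HV. apply nbhs0_prod. exists V (fun _ => True); auto. apply filter_true.
Qed.

Lemma jointly_ucont_snd f : ucont Y f -> jointly_ucont X Y (fun _ y => f y).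
Proof.
  intros Hf. apply (ucont_comp (X := prod_group X Y) f snd Hf).
  apply (affine_ucont_map (X := prod_group X Y) _ snd).
  - intros [x y] [d e]. simpl. abelian.
  - intros V HV. apply nbhs0_prod. exists (fun _ => True) V; auto. apply filter_true.
Qed.

Lemma jointly_ucont_col F y : jointly_ucont X Y F -> ucont X (fun x => F x y).
Proof.
  intros HF.
  apply (ucont_comp (X := X) (Y := prod_group X Y) _ (fun x => (x, y)) HF).
  apply (affine_ucont_map (Y := prod_group X Y) _ (fun d => (d, 𝟎))).
  - intros x d. simpl. f_equal; abelian.
  - intros W HW. apply nbhs0_prod in HW as [U V HU HV HW].
    generalize HU. apply filter_imp. intros d Hd. apply HW; [exact Hd|now apply nbhs0_zero].
Qed.

Lemma jointly_ucont_add f (phi : Y -> X) : ucont X f ->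
  (forall y d, phi (y ⊕ d) = phi y ⊕ phi d) ->
  (forall V, nbhs0 X V -> nbhs0 Y (fun d => V (phi d))) ->
  jointly_ucont X Y (fun x y => f (x ⊕ phi y)).
Proof.
  intros Hf Hadd Hphi.
  apply (ucont_comp (X := prod_group X Y) f (fun p => fst p ⊕ phi (snd p)) Hf).
  apply (affine_ucont_map (X := prod_group X Y) _ (fun p => fst p ⊕ phi (snd p))).
  - intros [x y] [d e]. simpl. rewrite Hadd. abelian.
  - intros V HV. destruct (nbhs0_add V HV) as (W & HW & HWV).
    apply nbhs0_prod. exists W (fun d => W (phi d)); auto.
Qed.
End JointContinuity.

Lemma jointly_ucont_sub {G : TopAbGroup} {HG : TopologicalGroup G} (f : G -> C) :
  ucont G f -> jointly_ucont G G (fun x y => f (x ⊖ y)).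
Proof.
  intros Hf. apply (jointly_ucont_add f (fun y => ⊖ y) Hf); [|apply nbhs0_opp].
  intros y d. abelian.
Qed.

(** * The invariant mean *)

Section FiniteSums.
Context {A : Type}.
Implicit Types (L : list A) (h : A -> C).

Definition Csum L h : C := fold_right (fun a s => h a + s)%C 0%C L.

Lemma Csum_ext L h k : (forall a, h a = k a) -> Csum L h = Csum L k.
Proof. intros H. induction L as [|a L IH]; simpl; congruence. Qed.

Lemma Csum_plus L h k : Csum L (fun a => h a + k a)%C = (Csum L h + Csum L k)%C.
Proof. induction L as [|a L IH]; simpl; [|rewrite IH]; ring. Qed.

Lemma Csum_scal L c h : Csum L (fun a => c * h a)%C = (c * Csum L h)%C.
Proof. induction L as [|a L IH]; simpl; [|rewrite IH]; ring. Qed.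

Lemma Csum_const L c : Csum L (fun _ => c) = (INR (length L) * c)%C.
Proof.
  induction L as [|a L IH]; [simpl; ring|].
  change (Csum (a :: L) (fun _ => c)) with (c + Csum L (fun _ => c))%C.
  rewrite IH. change (length (a :: L)) with (S (length L)). rewrite S_INR, RtoC_plus. ring.
Qed.

Lemma Csum_app L L' h : Csum (L ++ L') h = (Csum L h + Csum L' h)%C.
Proof. induction L as [|a L IH]; simpl; [|rewrite IH]; ring. Qed.

Lemma Csum_conj L h : Csum L (fun a => Cconj (h a)) = Cconj (Csum L h).
Proof.
  induction L as [|a L IH]; simpl; [apply injective_projections; simpl; ring|].
  now rewrite IH, Cplus_conj.
Qed.

Lemma Csum_Re L h : Csum L (fun a => RtoC (Re (h a))) = RtoC (Re (Csum L h)).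
Proof. induction L as [|a L IH]; simpl; [reflexivity|]. now rewrite IH, <- RtoC_plus. Qed.

Lemma Csum_dominated L h k : (forall a, Cmod (h a) <= Re (k a)) -> Cmod (Csum L h) <= Re (Csum L k).
Proof.
  intros H. induction L as [|a L IH]; simpl; [rewrite Cmod_0; apply Rle_refl|].
  apply Rle_trans with (1 := Cmod_triangle _ _). specialize (H a). unfold Re in *. lra.
Qed.

Lemma Csum_lower_bound L h m b : (forall a, m <= Re (h a)) -> In b L ->
  INR (length L) * m + (Re (h b) - m) <= Re (Csum L h).
Proof.
  intros Hm. assert (Hlow : forall L', INR (length L') * m <= Re (Csum L' h)).
  { intros L'. induction L' as [|a L' IH]; [simpl; lra|].
    change (length (a :: L')) with (S (length L')). rewrite S_INR. simpl. specialize (Hm a).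
    unfold Re in *. lra. }
  induction L as [|a L IH]; [intros []|].
  change (length (a :: L)) with (S (length L)). rewrite S_INR. simpl. intros [->|Hb].
  - specialize (Hlow L). unfold Re in *. lra.
  - specialize (IH Hb). specialize (Hm a). unfold Re in *. lra.
Qed.
End FiniteSums.

Lemma Csum_map {A B} (phi : A -> B) L h : Csum (map phi L) h = Csum L (fun a => h (phi a)).
Proof. induction L as [|a L IH]; simpl; congruence. Qed.

Lemma Csum_flat_map {A B} (phi : A -> list B) L h :
  Csum (flat_map phi L) h = Csum L (fun a => Csum (phi a) h).
Proof. induction L as [|a L IH]; simpl; [reflexivity|]. now rewrite Csum_app, IH. Qed.

Lemma Csum_exchange {A B} (L : list A) (L' : list B) (h : A -> B -> C) :
  Csum L (fun a => Csum L' (h a)) = Csum L' (fun b => Csum L (fun a => h a b)).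
Proof.
  induction L as [|a L IH]; simpl.
  - induction L' as [|b L' IH]; simpl; [reflexivity|]. rewrite <- IH. ring.
  - now rewrite IH, <- Csum_plus.
Qed.

Section Averages.
Context {G : TopAbGroup} {HG : is_abelian_group G}.
Implicit Types (L : list G) (f g : G -> C).

Definition average L f (x : G) : C := (RtoC (/ INR (length L)) * Csum L (fun a => f (x ⊕ a)))%C.

Lemma INR_length_ge1 L : L <> [] -> 1 <= INR (length L).
Proof. destruct L; [congruence|]. intros _. apply (le_INR 1). simpl. lia. Qed.

Lemma average_singleton a f x : average [a] f x = f (x ⊕ a).
Proof. unfold average. simpl. rewrite Rinv_1. ring. Qed.

Lemma average_plus L f g x : average L (fun y => f y + g y)%C x = (average L f x + average L g x)%C.
Proof. unfold average. rewrite Csum_plus. ring. Qed.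

Lemma average_scal L c f x : average L (fun y => c * f y)%C x = (c * average L f x)%C.
Proof. unfold average. rewrite Csum_scal. ring. Qed.

Lemma average_const L c x : L <> [] -> average L (fun _ => c) x = c.
Proof.
  intros HL. pose proof (INR_length_ge1 L HL) as Hn. unfold average.
  rewrite Csum_const, Cmult_assoc, <- RtoC_mult, Rinv_l by lra. ring.
Qed.

Lemma average_conj L f x : average L (fun y => Cconj (f y)) x = Cconj (average L f x).
Proof.
  unfold average. rewrite Csum_conj, Cmult_conj. f_equal. apply injective_projections; simpl; ring.
Qed.

Lemma average_Re L f x : average L (fun y => RtoC (Re (f y))) x = RtoC (Re (average L f x)).
Proof. unfold average. now rewrite Csum_Re, re_scal_l, RtoC_mult. Qed.

Lemma average_shift L f b x : average L (fun y => f (y ⊕ b)) x = average L f (x ⊕ b).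
Proof. unfold average. f_equal. apply Csum_ext. intros a. f_equal. abelian. Qed.

Lemma average_opp L f x : average (map (tg_opp G) L) (fun y => f (⊖ y)) x = average L f (⊖ x).
Proof.
  unfold average. rewrite length_map, Csum_map. f_equal. apply Csum_ext. intros a. f_equal. abelian.
Qed.

Lemma average_commute L L' f x : average L (average L' f) x = average L' (average L f) x.
Proof.
  unfold average. rewrite !Csum_scal, Csum_exchange, !Cmult_assoc, (Cmult_comm (RtoC _)). f_equal.
  apply Csum_ext. intros b. apply Csum_ext. intros a. f_equal. abelian.
Qed.

Lemma average_comp L L' : L <> [] -> L' <> [] -> exists M, M <> [] /\
  forall f x, average M f x = average L (average L' f) x.
Proof.
  intros HL HL'. exists (flat_map (fun a => map (tg_add G a) L') L). split.
  - destruct L as [|a L]; [easy|]. destruct L' as [|b L']; [easy|]. discriminate.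
  - intros f x. unfold average. rewrite Csum_scal, Csum_flat_map, Cmult_assoc.
    rewrite <- RtoC_mult, <- Rinv_mult. f_equal.
    + do 2 f_equal. rewrite <- mult_INR. f_equal. clear. induction L as [|a L IH]; [reflexivity|].
      simpl. now rewrite length_app, length_map, IH.
    + apply Csum_ext. intros a. rewrite Csum_map. apply Csum_ext. intros b. f_equal. abelian.
Qed.

Lemma average_dominated L f g x : (forall y, Cmod (f y) <= Re (g y)) ->
  Cmod (average L f x) <= Re (average L g x).
Proof.
  intros H. unfold average. rewrite Cmod_mult, Cmod_R, re_scal_l.
  pose proof (pos_INR (length L)) as Hn.
  assert (Hn' : 0 <= / INR (length L)).
  { destruct Hn as [Hn| <-]; [now left; apply Rinv_0_lt_compat|]. rewrite Rinv_0. lra. }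
  rewrite Rabs_pos_eq by exact Hn'. apply Rmult_le_compat_l; [exact Hn'|]. now apply Csum_dominated.
Qed.

Lemma average_dist_le L f g eps x : L <> [] -> (forall y, Cmod (f y - g y) <= eps) ->
  Cmod (average L f x - average L g x) <= eps.
Proof.
  intros HL H.
  replace (_ - _)%C with (average L (fun y => f y + (-1) * g y) x)%C
    by (rewrite average_plus, average_scal; ring).
  rewrite <- (re_RtoC eps), <- (average_const L eps x HL). apply average_dominated. intros y.
  rewrite re_RtoC. replace (_ + _)%C with (f y - g y)%C by ring. apply H.
Qed.

Lemma average_close L f c eps : L <> [] -> (forall y, Cmod (f y - c) <= eps) ->
  forall x, Cmod (average L f x - c) <= eps.
Proof. intros HL H x. rewrite <- (average_const L c x HL). now apply average_dist_le. Qed.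

(* Translates of [y] by a covering list come back close to [y], so averaging over the list lifts
   the lower bound [m] by a definite fraction of the excess of [f y] over [m]. *)
Lemma average_lower_bound L f (V : G -> Prop) m e :
  (forall x, exists a, In a L /\ V (x ⊖ a)) ->
  (forall d, V d -> forall x, Cmod (f (x ⊕ d) - f x) <= e) -> (forall x, m <= Re (f x)) ->
  forall x y, m + (Re (f y) - e - m) / INR (length L) <= Re (average L f x).
Proof.
  intros HL Hf Hm x y. destruct (HL (y ⊖ x)) as (a & Ha & HV).
  assert (Hn : 1 <= INR (length L)) by (apply INR_length_ge1; now intros ->).
  assert (Hclose : Re (f y) - e <= Re (f (x ⊕ a))).
  { specialize (Hf _ HV (x ⊕ a)). replace (x ⊕ a ⊕ (y ⊖ x ⊖ a)) with y in Hf by abelian.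
    pose proof (Re_dist_le (f y) (f (x ⊕ a))) as Hre. apply Rabs_le_between in Hre. lra. }
  unfold average. rewrite re_scal_l.
  apply Rmult_le_reg_l with (INR (length L)); [lra|].
  replace (INR (length L) * (m + (Re (f y) - e - m) / INR (length L)))
    with (INR (length L) * m + (Re (f y) - e - m)) by (field; lra).
  rewrite <- Rmult_assoc, Rinv_r, Rmult_1_l by lra.
  apply Rle_trans with (2 := Csum_lower_bound L (fun a => f (x ⊕ a)) m a (fun a => Hm _) Ha). lra.
Qed.
End Averages.

Definition is_mean (G : TopAbGroup) (f : G -> C) (c : C) : Prop :=
  forall eps, 0 < eps -> exists L, L <> [] /\ forall x, Cmod (average L f x - c) <= eps.

Section IsMean.
Context {G : TopAbGroup} {HG : is_abelian_group G}.
Implicit Types f g : G -> C.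

Lemma is_mean_common f g c d eps : is_mean G f c -> is_mean G g d -> 0 < eps ->
  exists L, L <> [] /\ forall x, Cmod (average L f x - c) <= eps /\ Cmod (average L g x - d) <= eps.
Proof.
  intros Hf Hg He.
  destruct (Hf eps He) as (L & HL & Hc). destruct (Hg eps He) as (L' & HL' & Hd).
  destruct (average_comp L' L HL' HL) as (M & HM & HMf). exists M. split; [exact HM|]. intros x.
  rewrite !HMf. split; [now apply average_close|].
  rewrite average_commute. now apply average_close.
Qed.

Lemma is_mean_unique f c d : is_mean G f c -> is_mean G f d -> c = d.
Proof.
  intros Hc Hd. apply Ceq_minus, Cmod_eq_0, Rle_antisym; [|apply Cmod_ge_0].
  apply le_epsilon. intros eps He.
  destruct (is_mean_common f f c d (eps / 2) Hc Hd) as (L & _ & H); [lra|].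
  destruct (H 𝟎) as [Hcf Hfd]. rewrite Cmod_minus_sym in Hcf.
  pose proof (Cmod_minus_triangle c (average L f 𝟎) d). lra.
Qed.

Lemma is_mean_plus f g c d :
  is_mean G f c -> is_mean G g d -> is_mean G (fun x => f x + g x)%C (c + d)%C.
Proof.
  intros Hc Hd eps He. destruct (is_mean_common f g c d (eps / 2) Hc Hd) as (L & HL & H); [lra|].
  exists L. split; [exact HL|]. intros x. rewrite average_plus. destruct (H x) as [Hfc Hgd].
  replace (_ - _)%C with ((average L f x - c) + (average L g x - d))%C by ring.
  apply Rle_trans with (1 := Cmod_triangle _ _). lra.
Qed.

Lemma is_mean_scal a f c : is_mean G f c -> is_mean G (fun x => a * f x)%C (a * c)%C.
Proof.
  intros Hc eps He. pose proof (Cmod_ge_0 a) as Ha.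
  assert (Hd : 0 < eps / (Cmod a + 1)) by (apply Rdiv_lt_0_compat; lra).
  destruct (Hc _ Hd) as (L & HL & H). exists L. split; [exact HL|]. intros x.
  rewrite average_scal. replace (_ - _)%C with (a * (average L f x - c))%C by ring.
  rewrite Cmod_mult. specialize (H x).
  replace eps with ((Cmod a + 1) * (eps / (Cmod a + 1))) by (field; lra).
  apply Rmult_le_compat; auto using Cmod_ge_0; lra.
Qed.

Lemma is_mean_const c : is_mean G (fun _ => c) c.
Proof.
  intros eps He. exists [𝟎]. split; [discriminate|]. intros x.
  rewrite average_const by discriminate.
  replace (c - c)%C with (RtoC 0) by ring. rewrite Cmod_0. lra.
Qed.

Lemma is_mean_conj f c : is_mean G f c -> is_mean G (fun x => Cconj (f x)) (Cconj c).
Proof.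
  intros Hc eps He. destruct (Hc eps He) as (L & HL & H). exists L. split; [exact HL|]. intros x.
  now rewrite average_conj, <- Cminus_conj, Cmod_conj.
Qed.

Lemma is_mean_opp f c : is_mean G f c -> is_mean G (fun x => f (⊖ x)) c.
Proof.
  intros Hc eps He. destruct (Hc eps He) as (L & HL & H). exists (map (tg_opp G) L). split.
  - now destruct L.
  - intros x. rewrite average_opp. apply H.
Qed.

Lemma is_mean_average L f c : L <> [] -> is_mean G f c -> is_mean G (average L f) c.
Proof.
  intros HL Hc eps He. destruct (Hc eps He) as (M & HM & H). exists M. split; [exact HM|]. intros x.
  rewrite average_commute. now apply average_close.
Qed.

Lemma is_mean_shift a f c : is_mean G f c -> is_mean G (fun x => f (x ⊕ a)) c.
Proof.
  intros Hc eps He. destruct (Hc eps He) as (L & HL & H). exists L. split; [exact HL|]. intros x.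
  rewrite average_shift. apply H.
Qed.

Lemma is_mean_dominated f g c d : is_mean G f c -> is_mean G g d ->
  (forall x, Cmod (f x) <= Re (g x)) -> Cmod c <= Re d.
Proof.
  intros Hc Hd H. apply le_epsilon. intros eps He.
  destruct (is_mean_common f g c d (eps / 2) Hc Hd) as (L & _ & HL); [lra|].
  destruct (HL 𝟎) as [Hfc Hgd]. pose proof (average_dominated L f g 𝟎 H) as Hfg.
  rewrite Cmod_minus_sym in Hfc.
  pose proof (Cmod_triangle (c - average L f 𝟎) (average L f 𝟎)) as Htriangle.
  replace (c - average L f 𝟎 + average L f 𝟎)%C with c in Htriangle by ring.
  pose proof (Re_dist_le (average L g 𝟎) d) as Hre. apply Rabs_le_between in Hre. lra.
Qed.

Lemma is_mean_Csum {A} (L : list A) (h : A -> G -> C) c :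
  (forall a, is_mean G (h a) (c a)) -> is_mean G (fun x => Csum L (fun a => h a x)) (Csum L c).
Proof.
  intros H. induction L as [|a L IH]; [exact (is_mean_const 0)|].
  apply (is_mean_plus (h a) (fun x => Csum L (fun a => h a x))); auto.
Qed.

Lemma is_mean_common_list {A} (K : list A) (h : A -> G -> C) c eps :
  (forall a, is_mean G (h a) (c a)) -> 0 < eps -> exists L, L <> [] /\
    forall a, In a K -> forall x, Cmod (average L (h a) x - c a) <= eps.
Proof.
  intros H He. induction K as [|a K (L & HL & HK)].
  - exists [𝟎]. split; [discriminate|intros ? []].
  - destruct (H a eps He) as (L' & HL' & Ha).
    destruct (average_comp L L' HL HL') as (M & HM & HMf). exists M. split; [exact HM|].
    intros b Hb x. rewrite HMf. destruct Hb as [<-|Hb]; [now apply average_close|].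
    rewrite average_commute. apply average_close; auto.
Qed.
End IsMean.

Section MeanExists.
Context {G : TopAbGroup} {HG : PrecompactGroup G}.
Variable f : G -> C.
Hypothesis Hf : ucont G f.

Let lower_bound_of_average (s : R) : Prop := exists L, L <> [] /\ forall x, s <= Re (average L f x).

Lemma lower_bound_of_average_lub : exists t, is_lub lower_bound_of_average t.
Proof.
  destruct (ucont_bounded f Hf) as (B & _ & HB).
  assert (Hre : forall x, - B <= Re (f x) <= B).
  { intros x. apply Rabs_le_between, Rle_trans with (1 := re_le_Cmod _), HB. }
  destruct (completeness lower_bound_of_average) as (t & Ht); [| |now exists t].
  - exists B. intros s (L & HL & Hs). apply Rle_trans with (1 := Hs 𝟎).
    apply Rle_trans with (1 := Rle_abs _), Rle_trans with (1 := re_le_Cmod _).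
    replace (average L f 𝟎) with (average L f 𝟎 - 0)%C by ring.
    apply average_close; [exact HL|]. intros y. replace (f y - 0)%C with (f y) by ring. apply HB.
  - exists (- B), [𝟎]. split; [discriminate|]. intros x.
    rewrite average_singleton. apply Hre.
Qed.

(* An average whose minimum is close to the supremum [t] of all such minima cannot exceed [t] by
   much, since averaging once more would lift its minimum above [t]. *)
Lemma average_Re_nearly_constant : exists t, forall eps, 0 < eps ->
  exists L, L <> [] /\ forall x, Rabs (Re (average L f x) - t) <= eps.
Proof.
  destruct lower_bound_of_average_lub as (t & Ht). exists t. intros eps He.
  set (V := fun d => forall x, Cmod (f (x ⊕ d) - f x) < eps / 2).
  destruct (nbhs0_cover V) as (L0 & HL0n & HL0); [apply Hf; lra|].
  pose proof (INR_length_ge1 L0 HL0n) as Hn. set (n := INR (length L0)) in *.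
  assert (Hd : 0 < eps / 2 / n) by (apply Rdiv_lt_0_compat; lra).
  destruct (lub_approx _ _ _ Ht Hd) as (s & (L & HL & Hs) & Hst).
  exists L. split; [exact HL|]. intros y. set (m := t - eps / 2 / n) in *.
  assert (Hlift : m + (Re (average L f y) - eps / 2 - m) / n <= t).
  { apply Ht. destruct (average_comp L0 L HL0n HL) as (M & HM & HMf).
    exists M. split; [exact HM|]. intros x. rewrite HMf.
    apply (average_lower_bound L0 _ V m (eps / 2) HL0).
    - intros d Hd' z. rewrite <- average_shift. apply average_dist_le; [exact HL|].
      intros w. now apply Rlt_le.
    - intros z. specialize (Hs z). lra. }
  assert (Hdn : eps / 2 / n <= eps / 2) by (apply Rle_div_l; nra).
  apply Rabs_le. split; [specialize (Hs y); unfold m in *; lra|].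
  assert (Hup : (Re (average L f y) - eps / 2 - m) / n <= eps / 2 / n) by (unfold m in *; lra).
  apply Rmult_le_reg_r in Hup; [unfold m in *; lra|]. apply Rinv_0_lt_compat. lra.
Qed.

Lemma is_mean_Re_exists : exists c, is_mean G (fun x => RtoC (Re (f x))) c.
Proof.
  destruct average_Re_nearly_constant as (t & Ht). exists (RtoC t). intros eps He.
  destruct (Ht eps He) as (L & HL & H). exists L. split; [exact HL|]. intros x.
  rewrite average_Re, <- RtoC_minus, Cmod_R. apply H.
Qed.
End MeanExists.

Lemma is_mean_exists {G : TopAbGroup} {HG : PrecompactGroup G} (f : G -> C) :
  ucont G f -> exists c, is_mean G f c.
Proof.
  intros Hf. destruct (is_mean_Re_exists f Hf) as (c & Hc).
  destruct (is_mean_Re_exists _ (ucont_scal (- Ci)%C f Hf)) as (d & Hd).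
  exists (c + Ci * d)%C.
  replace f with (fun x => RtoC (Re (f x)) + Ci * RtoC (Re (- Ci * f x)))%C.
  - now apply is_mean_plus, is_mean_scal.
  - apply functional_extensionality. intros x. destruct (f x) as [u v].
    apply injective_projections; simpl; ring.
Qed.

Definition mean (G : TopAbGroup) (f : G -> C) : C := epsilon (inhabits (RtoC 0)) (is_mean G f).

Section Mean.
Context {G : TopAbGroup} {HG : PrecompactGroup G}.
Implicit Types f g : G -> C.

Lemma mean_unique f c : is_mean G f c -> mean G f = c.
Proof.
  intros H. apply (is_mean_unique f); [|exact H]. exact (epsilon_spec _ _ (ex_intro _ c H)).
Qed.

Lemma mean_ext f g : (forall x, f x = g x) -> mean G f = mean G g.
Proof. intros H. f_equal. now apply functional_extensionality. Qed.

Lemma mean_correct f : ucont G f -> is_mean G f (mean G f).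
Proof. intros Hf. exact (epsilon_spec _ _ (is_mean_exists f Hf)). Qed.

Lemma mean_plus f g : ucont G f -> ucont G g ->
  mean G (fun x => f x + g x)%C = (mean G f + mean G g)%C.
Proof. intros Hf Hg. apply mean_unique, is_mean_plus; now apply mean_correct. Qed.

Lemma mean_scal c f : ucont G f -> mean G (fun x => c * f x)%C = (c * mean G f)%C.
Proof. intros Hf. now apply mean_unique, is_mean_scal, mean_correct. Qed.

Lemma mean_const c : mean G (fun _ => c) = c.
Proof. apply mean_unique, is_mean_const. Qed.

Lemma mean_conj f : ucont G f -> mean G (fun x => Cconj (f x)) = Cconj (mean G f).
Proof. intros Hf. now apply mean_unique, is_mean_conj, mean_correct. Qed.

Lemma mean_opp f : ucont G f -> mean G (fun x => f (⊖ x)) = mean G f.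
Proof. intros Hf. now apply mean_unique, is_mean_opp, mean_correct. Qed.

Lemma mean_shift a f : ucont G f -> mean G (fun x => f (x ⊕ a)) = mean G f.
Proof. intros Hf. now apply mean_unique, is_mean_shift, mean_correct. Qed.

Lemma mean_reflect a f : ucont G f -> mean G (fun x => f (a ⊖ x)) = mean G f.
Proof.
  intros Hf. rewrite <- (mean_shift a f Hf).
  rewrite <- (mean_opp (fun x => f (x ⊕ a))) by now apply ucont_shift.
  apply mean_ext. intros x. f_equal. abelian.
Qed.

Lemma mean_dominated f g : ucont G f -> ucont G g ->
  (forall x, Cmod (f x) <= Re (g x)) -> Cmod (mean G f) <= Re (mean G g).
Proof. intros Hf Hg. now apply is_mean_dominated; apply mean_correct. Qed.

Lemma mean_dist_le f g eps : ucont G f -> ucont G g ->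
  (forall x, Cmod (f x - g x) <= eps) -> Cmod (mean G f - mean G g) <= eps.
Proof.
  intros Hf Hg H.
  replace (mean G f - mean G g)%C with (mean G (fun x => f x + (-1) * g x)%C)
    by (rewrite mean_plus, mean_scal by auto using ucont_scal; ring).
  rewrite <- (re_RtoC eps), <- (mean_const eps).
  apply mean_dominated;
    [apply ucont_plus; [exact Hf|now apply ucont_scal]|apply ucont_const|]. intros x.
  replace (_ + _)%C with (f x - g x)%C by ring. apply H.
Qed.

Lemma mean_Re_gt0 f x0 :
  ucont G f -> (forall x, 0 <= Re (f x)) -> 0 < Re (f x0) -> 0 < Re (mean G f).
Proof.
  intros Hf Hge Hx0. set (e := Re (f x0) / 2).
  set (V := fun d => forall x, Cmod (f (x ⊕ d) - f x) < e).
  destruct (nbhs0_cover V) as (L & HLn & HL); [apply Hf; unfold e; lra|].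
  pose proof (INR_length_ge1 L HLn) as Hn.
  assert (He : 0 < e / INR (length L)) by (apply Rdiv_lt_0_compat; unfold e; lra).
  apply Rlt_le_trans with (1 := He).
  rewrite <- (Rabs_pos_eq (e / _)), <- Cmod_R by lra.
  apply (is_mean_dominated _ _ _ _ (is_mean_const _)
    (is_mean_average L _ _ HLn (mean_correct f Hf))).
  intros x. rewrite Cmod_R, Rabs_pos_eq by lra.
  replace e with (Re (f x0) - e - 0) at 1 by (unfold e; lra). rewrite <- (Rplus_0_l (_ / _)).
  apply (average_lower_bound L f V 0 e HL); [|exact Hge].
  intros d Hd y. now apply Rlt_le.
Qed.

End Mean.

Section Fubini.
Context {X Y : TopAbGroup} {HX : PrecompactGroup X} {HY : PrecompactGroup Y}.
Variable F : X -> Y -> C.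
Hypothesis HF : jointly_ucont X Y F.

Lemma jointly_ucont_modulus eps : 0 < eps ->
  nbhs0 X (fun d => forall x y, Cmod (F (x ⊕ d) y - F x y) < eps).
Proof.
  intros He. specialize (HF eps He). apply nbhs0_prod in HF as [U V HU HV H].
  apply filter_imp with (2 := HU). intros d Hd x y.
  specialize (H d 𝟎 Hd (nbhs0_zero V HV) (x, y)). simpl in H. now rewrite tg_add_zero_r in H.
Qed.

Lemma ucont_mean : ucont X (fun x => mean Y (F x)).
Proof.
  intros eps He. apply filter_imp with (2 := jointly_ucont_modulus (eps / 2) ltac:(lra)).
  intros d Hd x. apply Rle_lt_trans with (eps / 2); [|lra].
  apply mean_dist_le; try now apply jointly_ucont_row. intros y. now apply Rlt_le.
Qed.

Lemma average_mean_uniform eps : 0 < eps -> exists L, L <> [] /\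
  forall x y, Cmod (average L (F x) y - mean Y (F x)) <= eps.
Proof.
  intros He.
  destruct (nbhs0_cover (G := X) _ (jointly_ucont_modulus (eps / 3) ltac:(lra))) as (K & _ & HK).
  destruct (is_mean_common_list K F (fun x => mean Y (F x)) (eps / 3)) as (L & HL & HKL); [|lra|].
  { intros x. now apply mean_correct, jointly_ucont_row. }
  exists L. split; [exact HL|]. intros x y. destruct (HK x) as (a & Ha & Hx).
  assert (Hxa : forall z, Cmod (F x z - F a z) <= eps / 3).
  { intros z. specialize (Hx a z). replace (a ⊕ (x ⊖ a)) with x in Hx by abelian. lra. }
  assert (Haverage : Cmod (average L (F x) y - average L (F a) y) <= eps / 3)
    by now apply average_dist_le.
  assert (Hmean : Cmod (mean Y (F a) - mean Y (F x)) <= eps / 3).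
  { apply mean_dist_le; try now apply jointly_ucont_row. intros z. now rewrite Cmod_minus_sym. }
  specialize (HKL a Ha y).
  pose proof (Cmod_minus_triangle (average L (F x) y) (average L (F a) y) (mean Y (F x))).
  pose proof (Cmod_minus_triangle (average L (F a) y) (mean Y (F a)) (mean Y (F x))). lra.
Qed.

Lemma mean_fubini :
  mean X (fun x => mean Y (F x)) = mean Y (fun y => mean X (fun x => F x y)).
Proof.
  symmetry. apply mean_unique. intros eps He.
  destruct (average_mean_uniform eps He) as (L & HL & H). exists L. split; [exact HL|]. intros y.
  assert (Hcol : forall z, ucont X (fun x => F x z)) by (intros z; now apply jointly_ucont_col).
  assert (Hexchange :
    is_mean X (fun x => average L (F x) y) (average L (fun z => mean X (fun x => F x z)) y)).
  { apply is_mean_scal, (is_mean_Csum L (fun a x => F x (y ⊕ a))). intros a.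
    now apply mean_correct. }
  rewrite <- (re_RtoC eps).
  apply (is_mean_dominated (fun x => average L (F x) y + (-1) * mean Y (F x))%C
    (fun _ => RtoC eps)).
  - replace (_ - _)%C with (average L (fun z => mean X (fun x => F x z)) y
      + (-1) * mean X (fun x => mean Y (F x)))%C by ring.
    apply is_mean_plus; [exact Hexchange|]. now apply is_mean_scal, mean_correct, ucont_mean.
  - apply is_mean_const.
  - intros x. replace (_ + _)%C with (average L (F x) y - mean Y (F x))%C by ring. apply H.
Qed.
End Fubini.

(** * The convolution algebra *)

Record ucfun (G : TopAbGroup) := Ucfun { ucfun_apply :> G -> C; ucfun_ucont : ucont G ucfun_apply }.
Arguments Ucfun {G}.
Arguments ucfun_apply {G}.
Arguments ucfun_ucont {G}.

Section ConvolutionAlgebra.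
Context {G : TopAbGroup} {HG : PrecompactGroup G}.
Implicit Types f g h : ucfun G.

Lemma ucfun_ext f g : (forall x, f x = g x) -> f = g.
Proof.
  destruct f as [f Hf], g as [g Hg]. simpl. intros H.
  assert (f = g) by now apply functional_extensionality. subst g.
  f_equal. apply proof_irrelevance.
Qed.

Lemma ucfun_congr f g x : f = g -> f x = g x.
Proof. now intros ->. Qed.

Definition fzero : ucfun G := Ucfun _ (ucont_const 0).
Definition fadd f g : ucfun G := Ucfun _ (ucont_plus f g (ucfun_ucont f) (ucfun_ucont g)).
Definition fscal c f : ucfun G := Ucfun _ (ucont_scal c f (ucfun_ucont f)).
Definition translate a f : ucfun G := Ucfun _ (ucont_shift f (ucfun_ucont f) a).
Definition star f : ucfun G :=
  Ucfun (fun x => Cconj (f (⊖ x))) (ucont_conj _ (ucont_opp f (ucfun_ucont f))).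

Lemma conv_kernel_ucont f g : jointly_ucont G G (fun x y => f (x ⊖ y) * g y)%C.
Proof.
  apply (ucont_mult (G := prod_group G G)).
  - apply (jointly_ucont_sub f), ucfun_ucont.
  - apply (jointly_ucont_snd g), ucfun_ucont.
Qed.

Definition conv f g : ucfun G :=
  Ucfun (fun x => mean G (fun y => f (x ⊖ y) * g y)%C) (ucont_mean _ (conv_kernel_ucont f g)).
End ConvolutionAlgebra.

Notation "f ∔ g" := (fadd f g) (at level 50, left associativity).
Notation "c ∙ f" := (fscal c f) (at level 38, right associativity).
Notation "f ∗ g" := (conv f g) (at level 40, left associativity).
Notation "f ^~" := (star f) (at level 30, format "f ^~").

Section ConvolutionLaws.
Context {G : TopAbGroup} {HG : PrecompactGroup G}.
Implicit Types f g h k : ucfun G.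

Lemma conv_integrand_ucont f g x : ucont G (fun y => f (x ⊖ y) * g y)%C.
Proof. exact (jointly_ucont_row _ x (conv_kernel_ucont f g)). Qed.

Lemma ucfun_neq0 f : f <> fzero -> exists x, f x <> 0%C.
Proof.
  intros Hf. apply NNPP. intros Hn. apply Hf, ucfun_ext. intros x. apply NNPP. intros Hx.
  apply Hn. now exists x.
Qed.

Lemma fscal_fscal c d f : c ∙ d ∙ f = (c * d)%C ∙ f.
Proof. apply ucfun_ext. intros x. simpl. ring. Qed.

Lemma fscal_1 f : RtoC 1 ∙ f = f.
Proof. apply ucfun_ext. intros x. simpl. ring. Qed.

Lemma fscal_zero c : c ∙ fzero = fzero :> ucfun G.
Proof. apply ucfun_ext. intros x. simpl. ring. Qed.

Lemma fscal_inv (c : C) f g : c <> 0%C -> c ∙ f = g -> f = (/ c)%C ∙ g.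
Proof. intros Hc <-. rewrite fscal_fscal, Cinv_l by exact Hc. now rewrite fscal_1. Qed.

Lemma conv_comm f g : f ∗ g = g ∗ f.
Proof.
  apply ucfun_ext. intros x. simpl.
  rewrite <- (mean_reflect x) by apply conv_integrand_ucont.
  apply mean_ext. intros y.
  replace (x ⊖ (x ⊖ y)) with y by abelian. ring.
Qed.

Lemma conv_assoc f g h : f ∗ (g ∗ h) = f ∗ g ∗ h.
Proof.
  apply ucfun_ext. intros x. simpl.
  transitivity (mean G (fun z => mean G (fun y => f (x ⊖ z) * (g (z ⊖ y) * h y))%C)).
  { apply mean_ext. intros z. symmetry.
    apply mean_scal, conv_integrand_ucont. }
  rewrite (mean_fubini (fun z y => f (x ⊖ z) * (g (z ⊖ y) * h y))%C).
  2:{ apply (ucont_mult (G := prod_group G G)); [|apply conv_kernel_ucont].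
      apply (jointly_ucont_fst (fun z => f (x ⊖ z))), ucont_reflect, ucfun_ucont. }
  apply mean_ext. intros y.
  rewrite (Cmult_comm _ (h y)), <- mean_scal by apply conv_integrand_ucont.
  rewrite <- (mean_shift (⊖ y) (fun z => h y * (f (x ⊖ y ⊖ z) * g z))%C)
    by apply ucont_scal, conv_integrand_ucont.
  apply mean_ext. intros z.
  replace (x ⊖ y ⊖ (z ⊖ y)) with (x ⊖ z) by abelian. ring.
Qed.

Lemma conv_fadd_l f g h : (f ∔ g) ∗ h = f ∗ h ∔ g ∗ h.
Proof.
  apply ucfun_ext. intros x. simpl. rewrite <- mean_plus by apply conv_integrand_ucont.
  apply mean_ext. intros y. ring.
Qed.

Lemma conv_fscal_l c f g : (c ∙ f) ∗ g = c ∙ (f ∗ g).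
Proof.
  apply ucfun_ext. intros x. simpl. rewrite <- mean_scal by apply conv_integrand_ucont.
  apply mean_ext. intros y. ring.
Qed.

Lemma conv_translate_l a f g : translate a f ∗ g = translate a (f ∗ g).
Proof.
  apply ucfun_ext. intros x. simpl.
  apply mean_ext. intros y. do 2 f_equal. abelian.
Qed.

Lemma star_conv f g : (f ∗ g)^~ = f^~ ∗ g^~.
Proof.
  apply ucfun_ext. intros x. simpl. rewrite <- mean_conj by apply conv_integrand_ucont.
  rewrite <- mean_opp by apply ucont_conj, conv_integrand_ucont.
  apply mean_ext. intros y.
  rewrite Cmult_conj. do 3 f_equal. abelian.
Qed.

Lemma conv_fadd_r f g h : h ∗ (f ∔ g) = h ∗ f ∔ h ∗ g.
Proof. rewrite !(conv_comm h). apply conv_fadd_l. Qed.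

Lemma conv_fscal_r c f g : f ∗ (c ∙ g) = c ∙ (f ∗ g).
Proof. rewrite !(conv_comm f). apply conv_fscal_l. Qed.

Lemma conv_translate_r a f g : f ∗ translate a g = translate a (f ∗ g).
Proof. rewrite !(conv_comm f). apply conv_translate_l. Qed.

Lemma conv_zero_r f : f ∗ fzero = fzero.
Proof.
  replace fzero with (RtoC 0 ∙ fzero : ucfun G) by apply fscal_zero.
  rewrite conv_fscal_r. apply ucfun_ext. intros x. simpl. ring.
Qed.

Lemma conv_swap f g h k : (f ∗ g) ∗ (h ∗ k) = (f ∗ h) ∗ (g ∗ k).
Proof. rewrite <- !conv_assoc. f_equal. rewrite !conv_assoc. f_equal. apply conv_comm. Qed.

Lemma star_fadd f g : (f ∔ g)^~ = f^~ ∔ g^~.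
Proof. apply ucfun_ext. intros x. apply Cplus_conj. Qed.

Lemma star_fscal c f : (c ∙ f)^~ = Cconj c ∙ f^~.
Proof. apply ucfun_ext. intros x. apply Cmult_conj. Qed.

Lemma star_fscal_real (r : R) f : (RtoC r ∙ f)^~ = RtoC r ∙ f^~.
Proof. now rewrite star_fscal, Cconj_RtoC. Qed.

Lemma star_star f : f^~^~ = f.
Proof. apply ucfun_ext. intros x. simpl. rewrite Cconj_conj. f_equal. abelian. Qed.

Lemma star_at_zero f : f^~ 𝟎 = Cconj (f 𝟎).
Proof. simpl. do 2 f_equal. abelian. Qed.
End ConvolutionLaws.

(** * The Hilbert norm *)

Section HilbertNorm.
Context {G : TopAbGroup} {HG : PrecompactGroup G}.
Implicit Types u v : ucfun G.

Definition sqnorm u : R := Re ((u ∗ u^~) 𝟎).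

Lemma ucont_mult_conj u : ucont G (fun x => u x * Cconj (u x))%C.
Proof. apply ucont_mult; [|apply ucont_conj]; apply ucfun_ucont. Qed.

Lemma conv_star_at_zero u : (u ∗ u^~) 𝟎 = mean G (fun x => u x * Cconj (u x))%C.
Proof.
  simpl. rewrite <- (mean_opp (fun x => u x * Cconj (u x))%C) by apply ucont_mult_conj.
  apply mean_ext. intros y. now rewrite tg_add_zero_l.
Qed.

Lemma sqnorm_mean u : sqnorm u = Re (mean G (fun x => u x * Cconj (u x))%C).
Proof. unfold sqnorm. now rewrite conv_star_at_zero. Qed.

Lemma conv_star_at_zero_sqnorm u : (u ∗ u^~) 𝟎 = RtoC (sqnorm u).
Proof.
  symmetry. apply Cconj_fixed_real. now rewrite <- star_at_zero, star_conv, star_star, conv_comm.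
Qed.

Lemma sqnorm_ge0 u : 0 <= sqnorm u.
Proof.
  rewrite sqnorm_mean. apply Rle_trans with (1 := Cmod_ge_0 (mean G (fun _ => 0%C))).
  apply mean_dominated; [apply ucont_const|apply ucont_mult_conj|].
  intros x. rewrite Cmod_0, <- Cmod2_conj, re_RtoC. apply pow2_ge_0.
Qed.

Lemma sqnorm_gt0 u : u <> fzero -> 0 < sqnorm u.
Proof.
  intros Hu. destruct (ucfun_neq0 u Hu) as (x & Hx). rewrite sqnorm_mean.
  apply (mean_Re_gt0 _ x); [apply ucont_mult_conj|intros y|]; rewrite <- Cmod2_conj, re_RtoC.
  - apply pow2_ge_0.
  - now apply pow_lt, Cmod_gt_0.
Qed.

Lemma sqnorm_fscal_real (r : R) u : sqnorm (RtoC r ∙ u) = r ^ 2 * sqnorm u.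
Proof.
  unfold sqnorm. rewrite star_fscal_real, conv_fscal_l, conv_fscal_r.
  simpl ucfun_apply. rewrite !re_scal_l. ring.
Qed.

Lemma conv_am_gm u v x : 2 * Cmod ((u ∗ v) x) <= sqnorm u + sqnorm v.
Proof.
  rewrite !sqnorm_mean, <- (mean_reflect x (fun y => u y * Cconj (u y))%C) by apply ucont_mult_conj.
  rewrite <- re_plus, <- mean_plus
    by (try apply ucont_mult_conj; apply (ucont_reflect _ (ucont_mult_conj u))).
  replace (2 * Cmod ((u ∗ v) x)) with (Cmod (2 * (u ∗ v) x)%C)
    by (rewrite Cmod_mult, Cmod_R, Rabs_pos_eq by lra; reflexivity).
  change ((u ∗ v) x) with (mean G (fun y => u (x ⊖ y) * v y)%C).
  rewrite <- mean_scal by apply conv_integrand_ucont.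
  apply mean_dominated.
  - apply ucont_scal, conv_integrand_ucont.
  - apply ucont_plus; [apply (ucont_reflect _ (ucont_mult_conj u))|apply ucont_mult_conj].
  - intros y. rewrite !Cmod_mult, Cmod_R, Rabs_pos_eq by lra.
    rewrite re_plus, <- !Cmod2_conj, !re_RtoC.
    pose proof (pow2_ge_0 (Cmod (u (x ⊖ y)) - Cmod (v y))). nra.
Qed.

Lemma conv_cauchy_schwarz u v x : Cmod ((u ∗ v) x) ^ 2 <= sqnorm u * sqnorm v.
Proof.
  apply sq_le_of_scaled_am_gm; auto using Cmod_ge_0, sqnorm_ge0. intros t Ht.
  pose proof (sqrt_lt_R0 t Ht) as Hs.
  pose proof (conv_am_gm (RtoC (sqrt t) ∙ u) (RtoC (/ sqrt t) ∙ v) x) as H.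
  rewrite conv_fscal_l, conv_fscal_r, fscal_fscal, <- RtoC_mult, Rinv_r, fscal_1 in H by lra.
  rewrite !sqnorm_fscal_real, pow_inv, pow2_sqrt in H by lra. unfold Rdiv. lra.
Qed.

Lemma sqnorm_conv_le u v : sqnorm (u ∗ v) <= sqnorm u * sqnorm v.
Proof.
  rewrite sqnorm_mean.
  rewrite <- (re_RtoC (sqnorm u * sqnorm v)), <- (mean_const (RtoC (sqnorm u * sqnorm v))).
  apply Rle_trans with (1 := Rle_abs _), Rle_trans with (1 := re_le_Cmod _).
  apply mean_dominated; [apply ucont_mult_conj|apply ucont_const|]. intros x.
  rewrite <- Cmod2_conj, Cmod_R, Rabs_pos_eq, re_RtoC by apply pow2_ge_0.
  apply conv_cauchy_schwarz.
Qed.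
End HilbertNorm.

(** * Log-convex sequences *)

Section LogConvexSequences.
Variable a : nat -> R.
Hypothesis a_ge0 : forall n, 0 <= a n.
Hypothesis a_0_gt0 : 0 < a 0%nat.
Hypothesis a_1_gt0 : 0 < a 1%nat.
Hypothesis log_convex : forall n, a (S n) ^ 2 <= a n * a (S (S n)).
Hypothesis submultiplicative : forall n m, a (S (n + m)) <= a n * a m.

Lemma log_convex_gt0 n : 0 < a n.
Proof.
  assert (H : 0 < a n /\ 0 < a (S n)); [|tauto]. induction n as [|n [Hn HSn]]; [auto|].
  split; [exact HSn|]. specialize (log_convex n). specialize (a_ge0 (S (S n))). nra.
Qed.

Let ratio n := a (S n) / a n.

Lemma log_convex_ratio_incr n : ratio n <= ratio (S n).
Proof.
  pose proof (log_convex_gt0 n) as Hn. pose proof (log_convex_gt0 (S n)) as HSn.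
  apply (Rmult_le_reg_r (a n * a (S n))); [nra|].
  replace (ratio n * (a n * a (S n))) with (a (S n) ^ 2) by (unfold ratio; field; lra).
  replace (ratio (S n) * (a n * a (S n))) with (a n * a (S (S n))) by (unfold ratio; field; lra).
  apply log_convex.
Qed.

Lemma log_convex_ratio_pow_le m n : ratio m ^ n * a m <= a (n + m)%nat.
Proof.
  induction n as [|n IH]; [simpl; lra|].
  pose proof (log_convex_gt0 (n + m)) as H.
  assert (Hmono : ratio m <= ratio (n + m)).
  { clear IH H. induction n as [|n IH]; [apply Rle_refl|].
    apply Rle_trans with (1 := IH), log_convex_ratio_incr. }
  assert (Hpos : 0 <= ratio m).
  { unfold ratio. apply Rlt_le, Rdiv_lt_0_compat; apply log_convex_gt0. }
  change (S n + m)%nat with (S (n + m)).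
  replace (a (S (n + m))) with (ratio (n + m) * a (n + m)%nat) by (unfold ratio; field; lra).
  change (ratio m ^ S n) with (ratio m * ratio m ^ n). rewrite Rmult_assoc.
  apply Rmult_le_compat; auto.
  apply Rmult_le_pos; [now apply pow_le|now apply Rlt_le, log_convex_gt0].
Qed.

Lemma log_convex_ratio_pow_bound m n : ratio m ^ S n <= a n.
Proof.
  apply (Rmult_le_reg_r (a m)); [apply log_convex_gt0|].
  apply Rle_trans with (1 := log_convex_ratio_pow_le m (S n)), submultiplicative.
Qed.

(* [mu] is the limit of the increasing ratios [a (n+1) / a n]. *)
Lemma log_convex_normalized_limit : exists mu l : R,
  0 < mu /\ 1 <= l /\ is_lim_seq (fun n => a n / mu ^ S n) l.
Proof.
  destruct (ex_finite_lim_seq_incr ratio (a 0%nat)) as (mu & Hmu).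
  { apply log_convex_ratio_incr. }
  { intros n. rewrite <- (pow_1 (ratio n)). apply log_convex_ratio_pow_bound. }
  pose proof (is_lim_seq_incr_compare _ _ Hmu log_convex_ratio_incr) as Hle.
  assert (Hpos : 0 < mu).
  { apply Rlt_le_trans with (2 := Hle 0%nat). now apply Rdiv_lt_0_compat. }
  assert (Hge : forall n, 1 <= a n / mu ^ S n).
  { intros n. apply Rle_div_r; [now apply Rlt_gt, pow_lt|]. rewrite Rmult_1_l.
    assert (Hpow : is_lim_seq (fun m => ratio m ^ S n) (mu ^ S n)).
    { apply (is_lim_seq_continuous (fun x => x ^ S n)); [|exact Hmu].
      apply derivable_continuous_pt, derivable_pt_pow. }
    exact (is_lim_seq_le _ _ _ _ (fun m => log_convex_ratio_pow_bound m n)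
      Hpow (is_lim_seq_const _)). }
  destruct (ex_finite_lim_seq_decr (fun n => a n / mu ^ S n) 1) as (l & Hl); [|exact Hge|].
  - intros n. specialize (Hle n). pose proof (log_convex_gt0 n) as Hn.
    pose proof (pow_lt mu (S n) Hpos) as Hp.
    apply Rle_div_l; [now apply Rlt_gt, pow_lt|].
    replace (a n / mu ^ S n * mu ^ S (S n)) with (mu * a n)
      by (change (mu ^ S (S n)) with (mu * mu ^ S n); field; lra).
    apply Rle_div_l in Hle; [exact Hle|lra].
  - exists mu, l. split; [exact Hpos|split; [|exact Hl]].
    exact (is_lim_seq_le _ _ _ _ Hge (is_lim_seq_const 1) Hl).
Qed.
End LogConvexSequences.

(** * Hermitian idempotents *)

Definition uniform_limit {G : TopAbGroup} (f : nat -> ucfun G) (g : ucfun G) : Prop :=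
  forall eps, 0 < eps -> eventually (fun n => forall x, Cmod (f n x - g x) <= eps).

Section UniformLimits.
Context {G : TopAbGroup} {HG : PrecompactGroup G}.
Implicit Types (f : nat -> ucfun G) (g h : ucfun G).

Lemma uniform_limit_exists f :
  (forall eps, 0 < eps -> exists N, forall n m, (N <= n)%nat -> (N <= m)%nat ->
    forall x, Cmod (f n x - f m x) <= eps) ->
  exists g, uniform_limit f g.
Proof.
  intros Hf.
  destruct (proj1 (filterlim_locally_cauchy (U := @fct_CompleteSpace G C_CompleteNormedModule)
    (F := eventually) (fun n => f n : G -> C))) as (g & Hg).
  { intros eps. destruct (Hf (eps / 2)) as (N & HN); [apply is_pos_div_2|].
    exists (fun n => (N <= n)%nat). split; [now exists N|]. intros n m Hn Hm x.
    apply C_NormedModule_mixin_compat1.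
    apply Rle_lt_trans with (1 := HN m n Hm Hn x). pose proof (cond_pos eps). lra. }
  assert (Hlim : forall eps, 0 < eps -> eventually (fun n => forall x, Cmod (f n x - g x) <= eps)).
  { intros eps He. assert (He2 : 0 < eps / 2) by lra.
    generalize (proj1 (filterlim_locally _ _) Hg (mkposreal _ He2)). apply filter_imp.
    intros n Hn x.
    apply Rlt_le, Rlt_le_trans with (1 := C_NormedModule_mixin_compat2 _ _ _ (Hn x)). simpl.
    pose proof (sqrt_less 2 ltac:(lra) ltac:(lra)). nra. }
  assert (Hucont : ucont G g).
  { apply ucont_limit. intros eps He. destruct (Hlim eps He) as (N & HN).
    exists (f N). split; [apply ucfun_ucont|]. now apply HN. }
  now exists (Ucfun g Hucont).
Qed.

Lemma uniform_limit_unique f g h : uniform_limit f g -> uniform_limit f h -> g = h.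
Proof.
  intros Hg Hh. apply ucfun_ext. intros x.
  apply Ceq_minus, Cmod_eq_0, Rle_antisym; [|apply Cmod_ge_0]. apply le_epsilon. intros eps He.
  destruct (filter_and (F := eventually) _ _ (Hg (eps / 2) ltac:(lra)) (Hh (eps / 2) ltac:(lra)))
    as (N & HN).
  destruct (HN N (le_n N)) as [HNg HNh]. specialize (HNg x). specialize (HNh x).
  rewrite Cmod_minus_sym in HNg. pose proof (Cmod_minus_triangle (g x) (f N x) (h x)). lra.
Qed.

Lemma uniform_limit_const g : uniform_limit (fun _ => g) g.
Proof.
  intros eps He. apply filter_forall. intros n x.
  replace (g x - g x)%C with (RtoC 0) by ring. rewrite Cmod_0. lra.
Qed.

Lemma uniform_limit_succ f g : uniform_limit f g -> uniform_limit (fun n => f (S n)) g.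
Proof.
  intros Hg eps He. destruct (Hg eps He) as (N & HN). exists N. intros n Hn. apply HN. lia.
Qed.

Lemma uniform_limit_star f g : uniform_limit f g -> uniform_limit (fun n => (f n)^~) (g^~).
Proof.
  intros Hg eps He. generalize (Hg eps He). apply filter_imp. intros n Hn x. simpl.
  rewrite <- Cminus_conj, Cmod_conj. apply Hn.
Qed.

Lemma uniform_limit_conv h f g : uniform_limit f g -> uniform_limit (fun n => h ∗ f n) (h ∗ g).
Proof.
  intros Hg eps He. destruct (ucont_bounded h (ucfun_ucont h)) as (B & HB0 & HB).
  assert (Hd : 0 < eps / (B + 1)) by (apply Rdiv_lt_0_compat; lra).
  generalize (Hg _ Hd). apply filter_imp. intros n Hn x. simpl.
  apply mean_dist_le; try apply conv_integrand_ucont. intros y.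
  replace (_ - _)%C with (h (x ⊖ y) * (f n y - g y))%C by ring. rewrite Cmod_mult.
  replace eps with ((B + 1) * (eps / (B + 1))) by (field; lra).
  apply Rmult_le_compat; auto using Cmod_ge_0. specialize (HB (x ⊖ y)). lra.
Qed.

Lemma uniform_limit_Re f g x : uniform_limit f g -> is_lim_seq (fun n => Re (f n x)) (Re (g x)).
Proof.
  intros Hg. apply is_lim_seq_spec. intros eps. pose proof (cond_pos eps) as He.
  generalize (Hg (eps / 2) ltac:(lra)). apply filter_imp. intros n Hn.
  apply Rle_lt_trans with (1 := Re_dist_le _ _). specialize (Hn x). lra.
Qed.
End UniformLimits.

Section HermitianPowers.
Context {G : TopAbGroup} {HG : PrecompactGroup G}.
Implicit Types u k psi : ucfun G.

Definition hermitian u : Prop := u^~ = u.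

Definition projection psi : Prop := hermitian psi /\ psi ∗ psi = psi.

(* There is no unit for convolution, so [conv_pow u n] is the power of exponent [n + 1]. *)
Fixpoint conv_pow u (n : nat) : ucfun G :=
  match n with O => u | S m => u ∗ conv_pow u m end.

Lemma conv_pow_add u n m : conv_pow u n ∗ conv_pow u m = conv_pow u (S (n + m)).
Proof. induction n as [|n IH]; [reflexivity|]. simpl. now rewrite <- conv_assoc, IH. Qed.

Lemma conv_pow_conv u v n : conv_pow (u ∗ v) n = conv_pow u n ∗ conv_pow v n.
Proof. induction n as [|n IH]; [reflexivity|]. simpl. rewrite IH. apply conv_swap. Qed.

Lemma conv_pow_fscal (c : C) u n : conv_pow (c ∙ u) n = (c ^ S n)%C ∙ conv_pow u n.
Proof.
  induction n as [|n IH]; simpl; [now rewrite Cmult_1_r|].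
  rewrite IH, conv_fscal_l, conv_fscal_r, fscal_fscal. reflexivity.
Qed.

Lemma hermitian_conv_pow u n : hermitian u -> hermitian (conv_pow u n).
Proof.
  unfold hermitian. intros Hu. induction n as [|n IH]; [exact Hu|]. simpl.
  now rewrite star_conv, Hu, IH.
Qed.

Lemma sqnorm_hermitian u : hermitian u -> sqnorm u = Re ((u ∗ u) 𝟎).
Proof. unfold sqnorm. now intros ->. Qed.

Lemma sqnorm_conv_pow_log_convex u n : hermitian u ->
  sqnorm (conv_pow u (S n)) ^ 2 <= sqnorm (conv_pow u n) * sqnorm (conv_pow u (S (S n))).
Proof.
  intros Hu. apply Rle_trans with (2 := conv_cauchy_schwarz _ _ 𝟎).
  rewrite sqnorm_hermitian by now apply hermitian_conv_pow.
  rewrite !conv_pow_add. replace (S n + S n)%nat with (n + S (S n))%nat by lia.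
  rewrite <- !Rsqr_pow2. apply Rsqr_le_abs_1. rewrite (Rabs_pos_eq (Cmod _)) by apply Cmod_ge_0.
  apply re_le_Cmod.
Qed.

Lemma sqnorm_conv_pow_sub k n m : hermitian k ->
  sqnorm (conv_pow k n ∔ RtoC (-1) ∙ conv_pow k m) =
  Re (conv_pow k (S (n + n)) 𝟎) - 2 * Re (conv_pow k (S (n + m)) 𝟎)
  + Re (conv_pow k (S (m + m)) 𝟎).
Proof.
  intros Hk. rewrite sqnorm_hermitian.
  - rewrite conv_fadd_l, !conv_fadd_r, !conv_fscal_l, !conv_fscal_r, !conv_pow_add.
    rewrite (Nat.add_comm m n).
    simpl ucfun_apply. rewrite !re_plus, !re_scal_l. ring.
  - unfold hermitian. now rewrite star_fadd, star_fscal_real, !hermitian_conv_pow.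
Qed.

Lemma conv_pow_cauchy k (l : R) : hermitian k -> is_lim_seq (fun n => Re (conv_pow k n 𝟎)) l ->
  forall eps, 0 < eps -> exists N, forall n m, (N <= n)%nat -> (N <= m)%nat ->
    forall x, Cmod (conv_pow k n x - conv_pow k m x) <= eps.
Proof.
  intros Hk Hl eps He. pose proof (sqnorm_ge0 k) as Hk0.
  set (d := eps ^ 2 / (4 * (sqnorm k + 1))).
  assert (Hd : 0 < d) by (apply Rdiv_lt_0_compat; nra).
  apply is_lim_seq_spec in Hl. destruct (Hl (mkposreal d Hd)) as (N & HN). simpl in HN.
  exists (S N). intros [|n] [|m] Hn Hm x; try lia.
  replace (conv_pow k (S n) x - conv_pow k (S m) x)%C
    with ((k ∗ (conv_pow k n ∔ RtoC (-1) ∙ conv_pow k m)) x)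
    by (rewrite conv_fadd_r, conv_fscal_r; simpl; ring).
  apply Rsqr_incr_0; [|apply Cmod_ge_0|lra]. rewrite !Rsqr_pow2.
  apply Rle_trans with (1 := conv_cauchy_schwarz _ _ x). rewrite sqnorm_conv_pow_sub by exact Hk.
  pose proof (HN (S (n + n)) ltac:(lia)) as Hnn. pose proof (HN (S (n + m)) ltac:(lia)) as Hnm.
  pose proof (HN (S (m + m)) ltac:(lia)) as Hmm. apply Rabs_def2 in Hnn, Hnm, Hmm.
  replace (eps ^ 2) with ((sqnorm k + 1) * (4 * d)) by (unfold d; field; lra).
  apply Rle_trans with (sqnorm k * (4 * d)); [apply Rmult_le_compat_l|]; nra.
Qed.

Lemma conv_pow_limit k (l : R) : hermitian k -> is_lim_seq (fun n => Re (conv_pow k n 𝟎)) l ->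
  exists psi, projection psi /\ k ∗ psi = psi /\ Re (psi 𝟎) = l.
Proof.
  intros Hk Hl. destruct (uniform_limit_exists _ (conv_pow_cauchy k l Hk Hl)) as (psi & Hpsi).
  assert (Hkpsi : k ∗ psi = psi).
  { apply (uniform_limit_unique (fun n => conv_pow k (S n))); [|now apply uniform_limit_succ].
    exact (uniform_limit_conv k _ _ Hpsi). }
  assert (Hpow : forall n, conv_pow k n ∗ psi = psi).
  { induction n as [|n IH]; [exact Hkpsi|]. simpl. now rewrite <- conv_assoc, IH. }
  exists psi. split; [split|split; [exact Hkpsi|]].
  - apply (uniform_limit_unique (conv_pow k)); [|exact Hpsi].
    intros eps He. generalize (uniform_limit_star _ _ Hpsi eps He). apply filter_imp. intros n Hn x.
    now rewrite <- (hermitian_conv_pow k n Hk).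
  - apply (uniform_limit_unique (fun n => psi ∗ conv_pow k n)); [now apply uniform_limit_conv|].
    intros eps He. generalize (uniform_limit_const psi eps He). apply filter_imp. intros n Hn x.
    now rewrite conv_comm, Hpow.
  - assert (H : Finite (Re (psi 𝟎)) = Finite l); [|now injection H].
    rewrite <- (is_lim_seq_unique _ _ Hl). symmetry. now apply is_lim_seq_unique, uniform_limit_Re.
Qed.

(* The powers of [phi ∗ phi], normalised by its largest eigenvalue, converge to the projection onto
   the corresponding eigenspace. *)
Lemma top_projection phi : hermitian phi -> phi <> fzero -> exists (mu : R) psi,
  0 < mu /\ projection psi /\ psi <> fzero /\ phi ∗ phi ∗ psi = RtoC mu ∙ psi.
Proof.
  intros Hphi Hphi0. pose proof (sqnorm_gt0 phi Hphi0) as Hpos.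
  destruct (log_convex_normalized_limit (fun n => sqnorm (conv_pow phi n)))
    as (mu & l & Hmu & Hl & Hlim).
  - intros n. apply sqnorm_ge0.
  - exact Hpos.
  - apply sqnorm_gt0. simpl. intros Hsquare.
    rewrite sqnorm_hermitian, Hsquare in Hpos by exact Hphi. simpl in Hpos. lra.
  - intros n. now apply sqnorm_conv_pow_log_convex.
  - intros n m. rewrite <- conv_pow_add. apply sqnorm_conv_le.
  - destruct (conv_pow_limit (RtoC (/ mu) ∙ (phi ∗ phi)) l) as (psi & Hpsi & Hkpsi & Hpsi0).
    + unfold hermitian. now rewrite star_fscal_real, star_conv, Hphi.
    + apply is_lim_seq_ext with (2 := Hlim). intros n.
      rewrite sqnorm_hermitian by now apply hermitian_conv_pow.
      rewrite conv_pow_fscal, conv_pow_conv, <- RtoC_pow, pow_inv. simpl ucfun_apply.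
      rewrite re_scal_l. apply Rmult_comm.
    + exists mu, psi. split; [exact Hmu|split; [exact Hpsi|split]].
      * intros ->. simpl in Hpsi0. lra.
      * rewrite <- Hkpsi at 2. rewrite conv_fscal_l, fscal_fscal, <- RtoC_mult.
        now rewrite Rinv_r, fscal_1 by lra.
Qed.
End HermitianPowers.

Section MinimalProjections.
Context {G : TopAbGroup} {HG : PrecompactGroup G}.
Implicit Types f phi psi rho : ucfun G.

Lemma projection_at_zero psi : projection psi -> psi 𝟎 = RtoC (sqnorm psi).
Proof. intros [Hh Hi]. rewrite <- conv_star_at_zero_sqnorm. now rewrite Hh, Hi. Qed.

Lemma projection_at_zero_neq0 psi : projection psi -> psi <> fzero -> psi 𝟎 <> 0%C.
Proof.
  intros Hpsi Hne0. rewrite projection_at_zero by exact Hpsi.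
  now apply RtoC_neq0, Rgt_not_eq, sqnorm_gt0.
Qed.

Lemma projection_sqnorm_ge1 psi : projection psi -> psi <> fzero -> 1 <= sqnorm psi.
Proof.
  intros [_ Hi] Hne0. pose proof (sqnorm_gt0 psi Hne0).
  pose proof (sqnorm_conv_le psi psi) as Hle. rewrite Hi in Hle. nra.
Qed.

Lemma projection_sub psi rho : projection psi -> projection rho -> rho ∗ psi = rho ->
  projection (psi ∔ RtoC (-1) ∙ rho).
Proof.
  intros [Hh Hi] [Hh' Hi'] Hle. split.
  - unfold hermitian. now rewrite star_fadd, star_fscal_real, Hh, Hh'.
  - rewrite conv_fadd_l, !conv_fadd_r, !conv_fscal_l, !conv_fscal_r.
    rewrite (conv_comm psi rho), Hle, Hi, Hi'.
    apply ucfun_ext. intros x. simpl. ring.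
Qed.

Definition minimal_projection psi : Prop := projection psi /\ psi <> fzero /\
  forall rho, projection rho -> rho <> fzero -> rho ∗ psi = rho -> rho = psi.

(* Passing from a projection to a smaller one lowers its squared norm by at least one. *)
Lemma minimal_projection_below psi0 : projection psi0 -> psi0 <> fzero ->
  exists psi, minimal_projection psi /\ psi ∗ psi0 = psi.
Proof.
  destruct (INR_unbounded (sqnorm psi0)) as (n & Hn). revert psi0 Hn.
  induction n as [|n IH]; intros psi0 Hn Hp Hne0.
  - pose proof (sqnorm_ge0 psi0). simpl in Hn. lra.
  - destruct (classic (minimal_projection psi0)) as [Hm|Hm].
    { exists psi0. split; [exact Hm|apply Hp]. }
    assert (Hrho : exists rho, projection rho /\ rho <> fzero /\ rho ∗ psi0 = rho /\ rho <> psi0).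
    { apply NNPP. intros Hno. apply Hm. split; [exact Hp|split; [exact Hne0|]].
      intros rho Hr Hr0 Hle. apply NNPP. intros Hne. apply Hno. now exists rho. }
    destruct Hrho as (rho & Hr & Hr0 & Hle & Hne).
    pose proof (projection_sub psi0 rho Hp Hr Hle) as Hd.
    assert (Hd0 : psi0 ∔ RtoC (-1) ∙ rho <> fzero).
    { intros Hd0. apply Hne, ucfun_ext. intros x. apply (ucfun_congr _ _ x) in Hd0.
      simpl in Hd0. replace (rho x) with (psi0 x - (psi0 x + -1 * rho x))%C by ring.
      rewrite Hd0. ring. }
    assert (Hdrop : sqnorm (psi0 ∔ RtoC (-1) ∙ rho) = sqnorm psi0 - sqnorm rho).
    { apply RtoC_inj. rewrite RtoC_minus, <- !projection_at_zero by assumption. simpl. ring. }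
    pose proof (projection_sqnorm_ge1 _ Hd Hd0) as Hge. rewrite S_INR in Hn.
    destruct (IH rho ltac:(lra) Hr Hr0) as (psi & Hpsi & Hpr).
    exists psi. split; [exact Hpsi|]. now rewrite <- Hpr, <- conv_assoc, Hle.
Qed.

Section UnderMinimalProjection.
Variable psi : ucfun G.
Hypothesis Hpsi : minimal_projection psi.

(* The top projection of [phi] lies below [psi], hence is equal to it. *)
Lemma minimal_projection_square phi : hermitian phi -> phi ∗ psi = phi ->
  exists r : R, phi ∗ phi = RtoC r ∙ psi.
Proof.
  intros Hh Hle. destruct (classic (phi = fzero)) as [->|Hphi0].
  { exists 0. rewrite conv_zero_r. apply ucfun_ext. intros x. simpl. ring. }
  destruct Hpsi as (_ & _ & Hmin).
  destruct (top_projection phi Hh Hphi0) as (mu & rho & Hmu & Hrho & Hrho0 & Heig).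
  assert (Hmu0 : RtoC mu <> 0%C) by now apply RtoC_neq0, Rgt_not_eq.
  symmetry in Heig. apply fscal_inv in Heig as Hrhoeq; [|exact Hmu0].
  assert (rho = psi) as ->.
  { apply Hmin; [exact Hrho|exact Hrho0|]. rewrite Hrhoeq, conv_fscal_l. f_equal.
    now rewrite <- conv_assoc, (conv_comm rho), conv_assoc, <- (conv_assoc phi phi), Hle. }
  exists mu. now rewrite Heig, <- conv_assoc, Hle.
Qed.

(* Polarization: compare the squares of [phi] and of [psi + phi]. *)
Lemma minimal_projection_scalar_hermitian phi : hermitian phi -> phi ∗ psi = phi ->
  exists c : C, phi = c ∙ psi.
Proof.
  intros Hh Hle. destruct Hpsi as ((Hph & Hpi) & _).
  destruct (minimal_projection_square phi Hh Hle) as (r & Hr).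
  destruct (minimal_projection_square (psi ∔ phi)) as (s & Hs).
  - unfold hermitian. now rewrite star_fadd, Hph, Hh.
  - now rewrite conv_fadd_l, Hpi, Hle.
  - rewrite conv_fadd_l, !conv_fadd_r, Hpi, Hr, (conv_comm psi), Hle in Hs.
    exists ((s - 1 - r) / 2)%C. apply ucfun_ext. intros x. apply (ucfun_congr _ _ x) in Hs.
    simpl in Hs |- *.
    replace ((s - 1 - r) / 2 * psi x)%C with ((s * psi x - psi x - r * psi x) / 2)%C by field.
    rewrite <- Hs. field.
Qed.

Lemma minimal_projection_scalar f : f ∗ psi = f -> exists c : C, f = c ∙ psi.
Proof.
  intros Hle. destruct Hpsi as ((Hph & _) & _).
  assert (Hstar : f^~ ∗ psi = f^~) by (rewrite <- Hph; now rewrite <- star_conv, Hle).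
  destruct (minimal_projection_scalar_hermitian (f ∔ f^~)) as (c & Hc).
  { unfold hermitian. rewrite star_fadd, star_star. apply ucfun_ext. intros x. apply Cplus_comm. }
  { now rewrite conv_fadd_l, Hle, Hstar. }
  destruct (minimal_projection_scalar_hermitian (Ci ∙ (f ∔ RtoC (-1) ∙ f^~))) as (d & Hd).
  { unfold hermitian. rewrite star_fscal, star_fadd, star_fscal_real, star_star.
    apply ucfun_ext. intros x. simpl. apply injective_projections; simpl; ring. }
  { now rewrite conv_fscal_l, conv_fadd_l, conv_fscal_l, Hle, Hstar. }
  exists ((c - Ci * d) / 2)%C. apply ucfun_ext. intros x.
  apply (ucfun_congr _ _ x) in Hc, Hd. simpl ucfun_apply in Hc, Hd |- *.
  replace ((c - Ci * d) / 2 * psi x)%C with ((c * psi x - Ci * (d * psi x)) / 2)%C by field.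
  rewrite <- Hc, <- Hd. apply injective_projections; simpl; field.
Qed.
End UnderMinimalProjection.
End MinimalProjections.

(** * Characters *)

Definition unitary_character {G : TopAbGroup} (chi : ucfun G) : Prop :=
  (forall x y, chi (x ⊕ y) = chi x * chi y)%C /\ (forall x, chi x * Cconj (chi x) = 1)%C.

Section Characters.
Context {G : TopAbGroup} {HG : PrecompactGroup G}.
Implicit Types f g chi psi : ucfun G.

Lemma unitary_character_at_zero chi : unitary_character chi -> chi 𝟎 = 1%C.
Proof.
  intros [Hm Hu]. specialize (Hu 𝟎). specialize (Hm 𝟎 𝟎). rewrite tg_add_zero_r in Hm.
  replace (chi 𝟎) with (chi 𝟎 * (chi 𝟎 * Cconj (chi 𝟎)))%C by (rewrite Hu; ring).
  now rewrite Cmult_assoc, <- Hm.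
Qed.

Lemma minimal_projection_character psi : minimal_projection psi ->
  exists (c : C) chi, unitary_character chi /\ c <> 0%C /\ psi = c ∙ chi.
Proof.
  intros Hpsi. pose proof Hpsi as ((Hh & Hi) & Hpsi0 & _).
  pose proof (projection_at_zero_neq0 psi (proj1 Hpsi) Hpsi0) as Hat0.
  set (chi := (/ psi 𝟎)%C ∙ psi).
  assert (Hone : chi 𝟎 = 1%C) by (simpl; field; exact Hat0).
  assert (Hmult : forall x y, chi (x ⊕ y) = (chi x * chi y)%C).
  { intros x y. destruct (minimal_projection_scalar psi Hpsi (translate y psi)) as (c & Hc).
    { now rewrite conv_translate_l, Hi. }
    assert (Hx : forall z, psi (z ⊕ y) = (c * psi z)%C).
    { intros z. exact (ucfun_congr _ _ z Hc). }
    pose proof (Hx 𝟎) as Hy. rewrite tg_add_zero_l in Hy. simpl.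
    rewrite Hx, Hy. field. exact Hat0. }
  assert (Hstar : chi^~ = chi).
  { unfold chi. rewrite star_fscal, Hh, projection_at_zero by exact (proj1 Hpsi). f_equal.
    rewrite <- RtoC_inv; [apply Cconj_RtoC|]. apply Rgt_not_eq, sqnorm_gt0, Hpsi0. }
  exists (psi 𝟎), chi. split; [split; [exact Hmult|]|split; [exact Hat0|]].
  - intros x. rewrite <- Hone. replace (tg_zero G) with (x ⊖ x) by abelian. rewrite Hmult. f_equal.
    rewrite <- (Cconj_conj (chi (⊖ x))). f_equal.
    exact (eq_sym (ucfun_congr _ _ x Hstar)).
  - unfold chi. now rewrite fscal_fscal, Cinv_r, fscal_1 by exact Hat0.
Qed.

Theorem characters_complete g : g <> fzero ->
  exists chi, unitary_character chi /\ g ∗ chi <> fzero.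
Proof.
  intros Hg. set (phi := g ∗ g^~).
  assert (Hphi : hermitian phi).
  { unfold hermitian, phi. now rewrite star_conv, star_star, conv_comm. }
  assert (Hphi0 : phi <> fzero).
  { intros H. pose proof (sqnorm_gt0 g Hg) as Hpos. unfold sqnorm in Hpos.
    change (0 < Re (phi 𝟎)) in Hpos. rewrite H in Hpos. simpl in Hpos. lra. }
  destruct (top_projection phi Hphi Hphi0) as (mu & psi0 & Hmu & Hpsi0 & Hne0 & Heig).
  destruct (minimal_projection_below psi0 Hpsi0 Hne0) as (psi & Hpsi & Hle).
  destruct (minimal_projection_character psi Hpsi) as (c & chi & Hchi & Hc & ->).
  exists chi. split; [exact Hchi|]. intros Hz.
  assert (Hmu0 : RtoC mu <> 0%C) by now apply RtoC_neq0, Rgt_not_eq.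
  assert (Heig' : RtoC mu ∙ (c ∙ chi) = fzero).
  { rewrite <- Hle, conv_comm, <- conv_fscal_l, <- Heig, <- conv_assoc, (conv_comm psi0), Hle.
    unfold phi. rewrite conv_fscal_r, (conv_comm g), <- !conv_assoc, Hz, !conv_zero_r.
    apply fscal_zero. }
  apply (proj1 (proj2 Hpsi)). apply fscal_inv in Heig'; [|exact Hmu0].
  now rewrite Heig', fscal_zero.
Qed.
End Characters.

(** * Bump functions *)

Section Chains.
Context {G : TopAbGroup} {HG : TopologicalGroup G}.
Variable Vs : nat -> G -> Prop.
Hypothesis Vs_nbhs0 : forall n, nbhs0 G (Vs n).
Hypothesis Vs_add3 : forall n u v w, Vs (S n) u -> Vs (S n) v -> Vs (S n) w -> Vs n (u ⊕ v ⊕ w).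

Lemma Vs_antitone n m x : (n <= m)%nat -> Vs m x -> Vs n x.
Proof.
  intros Hnm Hx. induction Hnm as [|m Hnm IH]; [exact Hx|]. apply IH.
  replace x with (x ⊕ 𝟎 ⊕ 𝟎) by abelian. apply Vs_add3; [exact Hx|now apply nbhs0_zero..].
Qed.

Definition chain_sum (l : list (nat * G)) : G := fold_right (fun p s => snd p ⊕ s) 𝟎 l.

Definition chain_weight (l : list (nat * G)) : R := fold_right (fun p s => (/ 2) ^ fst p + s) 0 l.

Definition is_chain (l : list (nat * G)) : Prop := List.Forall (fun p => Vs (fst p) (snd p)) l.

Lemma chain_sum_app l l' : chain_sum (l ++ l') = chain_sum l ⊕ chain_sum l'.
Proof. induction l as [|p l IH]; simpl; [|rewrite IH]; abelian. Qed.

Lemma chain_weight_app l l' : chain_weight (l ++ l') = chain_weight l + chain_weight l'.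
Proof. induction l as [|p l IH]; simpl; [|rewrite IH]; ring. Qed.

Lemma chain_weight_ge0 l : 0 <= chain_weight l.
Proof. induction l as [|p l IH]; simpl; [lra|]. pose proof (half_pow_gt0 (fst p)). lra. Qed.

Lemma chain_split l t : 0 <= t < chain_weight l -> exists l1 p l2, l = l1 ++ p :: l2 /\
  chain_weight l1 <= t < chain_weight l1 + (/ 2) ^ fst p.
Proof.
  revert t. induction l as [|p l IH]; simpl; intros t Ht; [lra|].
  destruct (Rlt_le_dec t ((/ 2) ^ fst p)) as [Hp|Hp].
  - exists [], p, l. simpl. split; [reflexivity|lra].
  - destruct (IH (t - (/ 2) ^ fst p)) as (l1 & q & l2 & -> & Hq); [lra|].
    exists (p :: l1), q, l2. simpl. split; [reflexivity|lra].
Qed.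

(* The chain is cut into two parts of at most half the weight and one element in between. *)
Lemma chain_sum_small n l : is_chain l -> chain_weight l < (/ 2) ^ n -> Vs n (chain_sum l).
Proof.
  revert n. induction l as [l IH] using (induction_ltof1 _ (@length _)). intros n Hl Hw.
  unfold ltof in IH.
  destruct l as [|p0 l0]; [exact (nbhs0_zero _ (Vs_nbhs0 n))|]. remember (p0 :: l0) as l eqn:El.
  assert (Hpos : 0 < chain_weight l).
  { subst l. simpl. pose proof (half_pow_gt0 (fst p0)). pose proof (chain_weight_ge0 l0). lra. }
  destruct (chain_split l (chain_weight l / 2)) as (l1 & p & l2 & Hsplit & Hp); [lra|].
  rewrite Hsplit in *. clear El Hsplit. rewrite chain_weight_app in *. simpl in Hw, Hp, Hpos.
  apply Forall_app in Hl as [Hl1 Hl2]. apply Forall_cons_iff in Hl2 as [Hpv Hl2].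
  assert (HnS : (/ 2) ^ S n = (/ 2) ^ n / 2) by (simpl; field).
  pose proof (chain_weight_ge0 l1). pose proof (chain_weight_ge0 l2).
  assert (Hpn : (S n <= fst p)%nat).
  { apply Nat.nle_gt. intros Hle. apply half_pow_decr in Hle. lra. }
  rewrite chain_sum_app. simpl. rewrite tg_add_assoc. apply Vs_add3.
  - apply (IH l1); auto; [rewrite length_app; simpl; lia|lra].
  - now apply Vs_antitone with (fst p).
  - apply (IH l2); auto; [rewrite length_app; simpl; lia|lra].
Qed.

(* [g x] is the supremum of [1 - w] over the weights [w] of the chains with sum [x]. *)
Lemma chain_bump_exists : exists g : G -> R, ucont G (fun x => RtoC (g x)) /\
  (forall x, 0 <= g x) /\ 0 < g 𝟎 /\ (forall x, 0 < g x -> Vs 0%nat x).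
Proof.
  set (E := fun x r => r = 0 \/ exists l, is_chain l /\ chain_sum l = x /\ r = 1 - chain_weight l).
  assert (Hlub : forall x, exists t, is_lub (E x) t).
  { intros x. destruct (completeness (E x)) as (t & Ht); [|exists 0; now left|now exists t].
    exists 1. intros r [->|(l & _ & _ & ->)]; [lra|].
    pose proof (chain_weight_ge0 l). lra. }
  destruct (choice _ Hlub) as (g & Hg).
  assert (Hg0 : forall x, 0 <= g x) by (intros x; apply Hg; now left).
  assert (Hstep : forall n x v, Vs n v -> g x <= g (v ⊕ x) + (/ 2) ^ n).
  { intros n x v Hv. apply Hg. intros r [->|(l & Hl & <- & ->)].
    - specialize (Hg0 (v ⊕ x)). pose proof (half_pow_gt0 n). lra.
    - assert (H : 1 - chain_weight ((n, v) :: l) <= g (v ⊕ chain_sum l)); [|simpl in H; lra].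
      apply Hg. right. exists ((n, v) :: l). split; [now constructor|auto]. }
  exists g. split; [|split; [exact Hg0|split]].
  - intros eps He.
    destruct (pow_lt_1_zero (/ 2) ltac:(rewrite Rabs_pos_eq; lra) eps He) as (n & Hn).
    specialize (Hn n (le_n n)). rewrite Rabs_pos_eq in Hn by (apply pow_le; lra).
    generalize (filter_and _ _ (Vs_nbhs0 n) (nbhs0_opp _ (Vs_nbhs0 n))). apply filter_imp.
    intros d [Hd Hd'] x. rewrite <- RtoC_minus, Cmod_R. apply Rle_lt_trans with (2 := Hn).
    apply Rabs_le. pose proof (Hstep n x d Hd) as Hdown. rewrite (tg_add_comm d x) in Hdown.
    pose proof (Hstep n (x ⊕ d) (⊖ d) Hd') as Hup.
    replace (⊖ d ⊕ (x ⊕ d)) with x in Hup by abelian. lra.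
  - apply Rlt_le_trans with 1; [lra|]. apply Hg. right. exists []. split; [constructor|].
    simpl. split; [reflexivity|ring].
  - intros x Hx.
    destruct (lub_approx _ _ _ (Hg x) Hx) as (r & [->|(l & Hl & <- & ->)] & Hr); [lra|].
    apply chain_sum_small; [exact Hl|simpl; lra].
Qed.
End Chains.

Section BumpFunctions.
Context {G : TopAbGroup} {HG : TopologicalGroup G}.

Lemma nbhs0_add3 V : nbhs0 G V ->
  exists W, nbhs0 G W /\ forall u v w, W u -> W v -> W w -> V (u ⊕ v ⊕ w).
Proof.
  intros HV. destruct (nbhs0_add V HV) as (V' & HV' & H).
  destruct (nbhs0_add V' HV') as (W & HW & H').
  exists (fun x => V' x /\ W x). split; [now apply filter_and|].
  intros u v w [_ Hu] [_ Hv] [Hw _]. auto.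
Qed.

Lemma bump_exists V : nbhs0 G V -> exists g : G -> R, ucont G (fun x => RtoC (g x)) /\
  (forall x, 0 <= g x) /\ 0 < g 𝟎 /\ (forall x, 0 < g x -> V x).
Proof.
  intros HV.
  destruct (choice (fun V W : {V | nbhs0 G V} => forall u v w,
    proj1_sig W u -> proj1_sig W v -> proj1_sig W w -> proj1_sig V (u ⊕ v ⊕ w)))
    as (next & Hnext).
  { intros [V' HV']. destruct (nbhs0_add3 V' HV') as (W & HW & H). now exists (exist _ W HW). }
  exact (chain_bump_exists (fun n => proj1_sig (Nat.iter n next (exist _ V HV)))
    (fun n => proj2_sig _) (fun n => Hnext _)).
Qed.
End BumpFunctions.

(** * Separation and extension of characters *)

Lemma characters_separate {G : TopAbGroup} {HG : PrecompactGroup G} (V : G -> Prop) a :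
  nbhs0 G V -> ~ V a -> exists chi : ucfun G, unitary_character chi /\ chi a <> 1%C.
Proof.
  intros HV Ha. destruct (bump_exists V HV) as (g & Hg & Hg0 & Hpos & HgV).
  set (b := Ucfun _ Hg). set (f := b ∔ RtoC (-1) ∙ translate a b).
  assert (Hf : f <> fzero).
  { intros Hf. apply (ucfun_congr _ _ 𝟎), (f_equal Re) in Hf. simpl in Hf.
    rewrite tg_add_zero_l in Hf.
    assert (g a <= 0) by (apply Rnot_lt_le; intros H; now apply Ha, HgV). lra. }
  destruct (characters_complete f Hf) as (chi & Hchi & Hne). exists chi. split; [exact Hchi|].
  intros Ha1. apply Hne. unfold f.
  assert (Htr : translate a chi = chi).
  { apply ucfun_ext. intros x. simpl. rewrite (proj1 Hchi), Ha1. ring. }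
  rewrite conv_fadd_l, conv_fscal_l, conv_translate_l, <- conv_translate_r, Htr.
  apply ucfun_ext. intros x. simpl. ring.
Qed.

Section CharacterExtension.
Context {X G : TopAbGroup} {HX : PrecompactGroup X} {HG : PrecompactGroup G}.
Variable phi : X -> G.
Hypothesis phi_add : forall x y, phi (x ⊕ y) = phi x ⊕ phi y.
Hypothesis phi_continuous : forall V, nbhs0 G V -> nbhs0 X (fun x => V (phi x)).
Hypothesis phi_embedding : forall V, nbhs0 X V -> exists U, nbhs0 G U /\ forall x, U (phi x) -> V x.
Variable gam : ucfun X.
Hypothesis Hgam : unitary_character gam.

(* Averaging a bump function against [gam] along the image of [phi]. *)
Lemma character_equivariant_exists : exists h : ucfun G, h <> fzero /\
  forall x, translate (phi x) h = gam x ∙ h.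
Proof.
  destruct (phi_embedding (fun d => forall x, Cmod (gam (x ⊕ d) - gam x) < 1)) as (U & HU & HUV).
  { apply ucfun_ucont. lra. }
  destruct (bump_exists U HU) as (g & Hg & Hg0 & Hpos & HgU).
  set (F := fun y x => (RtoC (g (y ⊕ phi x)) * Cconj (gam x))%C).
  assert (HF : jointly_ucont G X F).
  { apply (ucont_mult (G := prod_group G X)).
    - now apply (jointly_ucont_add (fun y => RtoC (g y))).
    - apply (jointly_ucont_snd (fun x => Cconj (gam x))), ucont_conj, ucfun_ucont. }
  exists (Ucfun _ (ucont_mean F HF)). split.
  - intros Hz. apply (ucfun_congr _ _ 𝟎), (f_equal Re) in Hz. simpl in Hz.
    assert (0 < Re (mean X (F 𝟎))); [|lra].
    assert (HRe : forall x, Re (F 𝟎 x) = g (phi x) * Re (gam x)).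
    { intros x. unfold F. now rewrite tg_add_zero_l, re_scal_l, re_conj. }
    assert (Hphi0 : phi 𝟎 = 𝟎) by (apply tg_add_idem; now rewrite <- phi_add, tg_add_zero_r).
    apply (mean_Re_gt0 _ 𝟎); [now apply jointly_ucont_row|intros x|]; rewrite HRe.
    + destruct (Hg0 (phi x)) as [Hp| <-]; [|lra].
      specialize (HUV x (HgU _ Hp) 𝟎).
      rewrite tg_add_zero_l, unitary_character_at_zero in HUV by exact Hgam.
      pose proof (Re_dist_le (gam x) 1) as Hre. rewrite re_RtoC in Hre.
      apply Rabs_le_between in Hre. apply Rmult_le_pos; lra.
    + rewrite Hphi0, unitary_character_at_zero by exact Hgam. simpl. lra.
  - intros z. apply ucfun_ext. intros y. simpl.
    assert (Hrow : ucont X (F y)) by now apply jointly_ucont_row.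
    rewrite <- mean_scal, <- (mean_shift z (fun x => gam z * F y x)%C) by now try apply ucont_scal.
    apply mean_ext. intros x. unfold F.
    rewrite phi_add, (proj1 Hgam), Cmult_conj.
    replace (y ⊕ (phi x ⊕ phi z)) with (y ⊕ phi z ⊕ phi x) by abelian.
    transitivity (RtoC (g (y ⊕ phi z ⊕ phi x)) * Cconj (gam x) * (gam z * Cconj (gam z)))%C;
      [|ring].
    rewrite (proj2 Hgam). ring.
Qed.

Theorem character_extension : exists chi : ucfun G, unitary_character chi /\
  forall x, chi (phi x) = gam x.
Proof.
  destruct character_equivariant_exists as (h & Hh & Heq).
  destruct (characters_complete h Hh) as (chi & Hchi & Hne). exists chi. split; [exact Hchi|].
  intros x. destruct (ucfun_neq0 _ Hne) as (y & Hy).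
  assert (Hshift : gam x ∙ (h ∗ chi) = chi (phi x) ∙ (h ∗ chi)).
  { rewrite <- conv_fscal_l, <- Heq, conv_translate_l, <- conv_translate_r, <- conv_fscal_r.
    f_equal. apply ucfun_ext. intros z. simpl. rewrite (proj1 Hchi). ring. }
  apply (ucfun_congr _ _ y) in Hshift. simpl ucfun_apply in Hshift.
  change (gam x * (h ∗ chi) y = chi (phi x) * (h ∗ chi) y)%C in Hshift.
  now apply Cmult_reg_r in Hshift.
Qed.
End CharacterExtension.

(** * Divisible groups *)

Section Multiples.
Context {D : TopAbGroup} {HD : is_abelian_group D}.

Lemma nsmul_add_r n (x y : D) : nsmul D n (x ⊕ y) = nsmul D n x ⊕ nsmul D n y.
Proof. induction n as [|n IH]; simpl; [|rewrite IH]; abelian. Qed.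

Lemma nsmul_add_l n m (x : D) : nsmul D (n + m) x = nsmul D n x ⊕ nsmul D m x.
Proof. induction n as [|n IH]; simpl; [|rewrite IH]; abelian. Qed.

Lemma nsmul_mul n m (x : D) : nsmul D (n * m) x = nsmul D n (nsmul D m x).
Proof. induction n as [|n IH]; simpl; [reflexivity|]. now rewrite nsmul_add_l, IH. Qed.
End Multiples.

Definition divisible (D : TopAbGroup) : Prop :=
  forall n (x : D), (0 < n)%nat -> exists y, nsmul D n y = x.

Lemma pigeonhole {A : Type} (c : nat -> A) (l : list A) : (forall i, In (c i) l) ->
  exists i j, (i < j <= length l)%nat /\ c i = c j.
Proof.
  intros Hc. apply NNPP. intros Hn.
  assert (Hnd : NoDup (map c (seq 0 (S (length l))))).
  { apply NoDup_map_NoDup_ForallPairs; [|apply seq_NoDup].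
    intros i j Hi Hj Hij. apply in_seq in Hi, Hj.
    destruct (Nat.lt_trichotomy i j) as [Hlt|[Heq|Hlt]]; [|exact Heq|]; exfalso; apply Hn.
    - exists i, j. split; [lia|exact Hij].
    - exists j, i. split; [lia|now symmetry]. }
  assert (Hincl : incl (map c (seq 0 (S (length l)))) l).
  { intros y Hy. apply in_map_iff in Hy as (i & <- & _). apply Hc. }
  pose proof (NoDup_incl_length Hnd Hincl) as Hlen.
  rewrite length_map, length_seq in Hlen. lia.
Qed.

Lemma divide_fact d n : (0 < d <= n)%nat -> Nat.divide d (fact n).
Proof.
  induction n as [|n IH]; intros Hd; [lia|]. change (fact (S n)) with (S n * fact n)%nat.
  destruct (Nat.eq_dec d (S n)) as [->|Hne]; [apply Nat.divide_factor_l|].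
  apply Nat.divide_mul_r, IH. lia.
Qed.

(* Two of the multiples [0 y, ..., m y] lie in the same coset when there are [m] cosets, so
   [(m!) y] lies in the subgroup; by divisibility every element is of this form. *)
Lemma divisible_finite_index_full {D : TopAbGroup} {HD : is_abelian_group D}
  (H : D -> Prop) (l : list D) : divisible D ->
  H 𝟎 -> (forall x y, H x -> H y -> H (x ⊖ y)) ->
  (forall x, exists g, In g l /\ H (x ⊖ g)) -> forall x, H x.
Proof.
  intros Hdiv Hzero Hsub Hl x.
  destruct (Hdiv (fact (length l)) x (lt_O_fact _)) as (y & <-).
  destruct (choice (fun i g => In g l /\ H (nsmul D i y ⊖ g)) (fun i => Hl _)) as (c & Hc).
  destruct (pigeonhole c l) as (i & j & Hij & Heq); [intros i; apply Hc|].
  assert (Hd : H (nsmul D (j - i) y)).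
  { replace (nsmul D (j - i) y) with ((nsmul D j y ⊖ c j) ⊖ (nsmul D i y ⊖ c j)).
    - apply Hsub; [apply Hc|]. rewrite <- Heq. apply Hc.
    - replace j with (i + (j - i))%nat at 1 by lia. rewrite nsmul_add_l. abelian. }
  destruct (divide_fact (j - i) (length l)) as (q & ->); [lia|]. rewrite nsmul_mul.
  induction q as [|q IH]; [exact Hzero|]. simpl.
  replace (_ ⊕ _) with (nsmul D (j - i) y ⊖ (𝟎 ⊖ nsmul D q (nsmul D (j - i) y))) by abelian. auto.
Qed.

(** * Compact groups *)

Lemma hausdorff_nbhs0 {G : TopAbGroup} (a : G) :
  hausdorff G -> a <> 𝟎 -> exists V, nbhs0 G V /\ ~ V a.
Proof.
  intros Hsep Ha. destruct (Hsep a 𝟎 Ha) as (U & V & _ & HV & Ua & V0 & HUV).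
  exists V. split; [now exists V|]. intros Va. exact (HUV a Ua Va).
Qed.

Existing Class is_compact_abelian_group.

Section CompactGroup.
Context {G : TopAbGroup} {HG : is_compact_abelian_group G}.

Lemma compact_finite_choice (P : G -> (G -> Prop) -> Prop) :
  (forall x, exists U, tg_open G U /\ U x /\ P x U) ->
  exists (U : G -> G -> Prop) (l : list G),
    (forall x, P x (U x)) /\ forall y, exists x, In x l /\ U x y.
Proof.
  intros H. destruct (choice _ H) as (U & HU).
  destruct HG as (_ & _ & _ & _ & Hcompact).
  destruct (Hcompact G U) as (l & Hl); [intros x; apply HU|intros x; exists x; apply HU|].
  exists U, l. split; [intros x; apply HU|exact Hl].
Qed.

#[export] Instance compact_topological_group : TopologicalGroup G.
Proof. now split; apply HG. Qed.

#[export] Instance compact_precompact_group : PrecompactGroup G.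
Proof.
  split; [exact compact_topological_group|]. intros V HV.
  destruct (compact_finite_choice (fun x U => forall y, U y -> V (y ⊖ x))) as (U & l & HU & Hl).
  { intros x. now apply open_translate. }
  exists l. intros x. destruct (Hl x) as (a & Ha & Hx). exists a. auto.
Qed.

End CompactGroup.

Lemma compact_injective_embedding {X G : TopAbGroup}
  {HX : is_compact_abelian_group X} {HG : TopologicalGroup G} (phi : X -> G) : hausdorff G ->
  (forall x y, phi (x ⊕ y) = phi x ⊕ phi y) -> (forall x, phi x = 𝟎 -> x = 𝟎) ->
  (forall V, nbhs0 G V -> nbhs0 X (fun x => V (phi x))) ->
  forall V, nbhs0 X V -> exists U, nbhs0 G U /\ forall x, U (phi x) -> V x.
Proof.
  intros Hsep Hadd Hinj Hphi V (O & HO & O0 & HOV).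
  set (P := fun (x : X) A => exists B, nbhs0 G B /\ forall z, A z -> B (phi z) -> V z).
  destruct (compact_finite_choice P) as (A & l & HA & Hl).
  - intros x. destruct (classic (O x)) as [Ox|Ox].
    { exists O. split; [exact HO|split; [exact Ox|]].
      exists (fun _ => True). split; [apply filter_true|auto]. }
    destruct (hausdorff_nbhs0 (phi x) Hsep) as (W & HW & HWx).
    { intros H. apply Hinj in H. congruence. }
    destruct (nbhs0_sub W HW) as (B & HB & HBW).
    destruct (open_translate _ x (Hphi B HB)) as (A & HA & Ax & HAB).
    exists A. split; [exact HA|split; [exact Ax|]]. exists B. split; [exact HB|].
    intros z Az Bz. exfalso. apply HWx.
    replace (phi x) with (phi z ⊖ phi (z ⊖ x)); [apply HBW; [exact Bz|now apply HAB]|].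
    replace (phi z) with (phi (z ⊖ x) ⊕ phi x); [abelian|]. rewrite <- Hadd. f_equal. abelian.
  - destruct (choice _ HA) as (B & HB).
    exists (fun y => forall x, In x l -> B x y). split.
    + apply Filter_forall_list; [exact _|]. intros x _. apply HB.
    + intros z Hz. destruct (Hl z) as (x & Hx & Az). apply (proj2 (HB x)); auto.
Qed.

(** * The dual group *)

Section IsCharacter.
Context {G : TopAbGroup} {HG : TopologicalGroup G}.

Lemma is_character_ucont (g : G -> C) : is_character G g -> ucont G g.
Proof.
  intros (Hn & Hm & Hc) eps He. destruct (Hc 𝟎 (eps ^ 2)) as (U & HU & U0 & H); [nra|].
  exists U. split; [exact HU|split; [exact U0|]]. intros d Ud x. specialize (H d Ud).
  rewrite (Cdist2_Cmod (g d) (g 𝟎)) in H.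
  assert (Hx : Cmod (g x) = 1).
  { specialize (Hn x). rewrite Cnorm2_Cmod in Hn. pose proof (Cmod_ge_0 (g x)). nra. }
  assert (Hd : g (x ⊕ d) = (g x * g d)%C) by apply Hm.
  assert (Hg0 : g x = (g x * g 𝟎)%C) by (rewrite <- (tg_add_zero_r x) at 1; apply Hm).
  replace (g (x ⊕ d) - g x)%C with (g x * (g d - g 𝟎))%C.
  2:{ transitivity (g x * g d - g x * g 𝟎)%C; [ring|]. now rewrite <- Hd, <- Hg0. }
  rewrite Cmod_mult, Hx. pose proof (Cmod_ge_0 (g d - g 𝟎)). nra.
Qed.

Lemma is_character_iff (g : G -> C) : is_character G g <->
  ucont G g /\ (forall x y, g (x ⊕ y) = g x * g y)%C /\ (forall x, g x * Cconj (g x) = 1)%C.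
Proof.
  split.
  - intros Hg. split; [now apply is_character_ucont|]. destruct Hg as (Hn & Hm & _).
    split; [exact Hm|]. intros x. rewrite <- Cmod2_conj, <- Cnorm2_Cmod. now f_equal.
  - intros (Hu & Hm & Hn). split; [|split; [exact Hm|]].
    + intros x. apply RtoC_inj. rewrite Cnorm2_Cmod, Cmod2_conj. apply Hn.
    + intros x eps He.
      destruct (open_translate _ x (Hu (sqrt eps) (sqrt_lt_R0 eps He))) as (U & HU & Ux & H).
      exists U. split; [exact HU|split; [exact Ux|]]. intros y Uy. specialize (H y Uy x).
      replace (x ⊕ (y ⊖ x)) with y in H by abelian. rewrite (Cdist2_Cmod (g y) (g x)).
      rewrite <- (pow2_sqrt eps) by lra. pose proof (Cmod_ge_0 (g y - g x)). nra.
Qed.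

End IsCharacter.

Section Dual.
Context {G : TopAbGroup} {HG : PrecompactGroup G}.

Definition dual_eval (gam : dual G) : G -> C := proj1_sig gam.

Lemma dual_ext (a b : dual G) : (forall x, dual_eval a x = dual_eval b x) -> a = b.
Proof.
  destruct a as [f Hf], b as [g Hg]. unfold dual_eval. simpl. intros H.
  assert (f = g) by now apply functional_extensionality. subst g. f_equal. apply proof_irrelevance.
Qed.

Definition ucfun_of_dual (gam : dual G) : ucfun G :=
  Ucfun (dual_eval gam) (is_character_ucont _ (proj2_sig gam)).

Lemma ucfun_of_dual_character gam : unitary_character (ucfun_of_dual gam).
Proof. exact (proj2 (proj1 (is_character_iff _) (proj2_sig gam))). Qed.

Definition dual_of_character (chi : ucfun G) (Hchi : unitary_character chi) : dual G :=
  exist _ (ucfun_apply chi) (proj2 (is_character_iff _) (conj (ucfun_ucont chi) Hchi)).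

Lemma character_one : unitary_character (Ucfun (G := G) _ (ucont_const 1)).
Proof. split; simpl; intros; apply injective_projections; simpl; ring. Qed.

Lemma character_mult (f g : ucfun G) : unitary_character f -> unitary_character g ->
  unitary_character (Ucfun _ (ucont_mult f g (ucfun_ucont f) (ucfun_ucont g))).
Proof.
  intros [Hf Hf1] [Hg Hg1]. split; simpl.
  - intros x y. rewrite Hf, Hg. ring.
  - intros x. rewrite Cmult_conj.
    transitivity ((f x * Cconj (f x)) * (g x * Cconj (g x)))%C; [ring|]. rewrite Hf1, Hg1. ring.
Qed.

Lemma character_conj (f : ucfun G) : unitary_character f ->
  unitary_character (Ucfun _ (ucont_conj f (ucfun_ucont f))).
Proof.
  intros [Hf Hf1]. split; simpl.
  - intros x y. now rewrite Hf, Cmult_conj.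
  - intros x. now rewrite Cconj_conj, Cmult_comm.
Qed.

(* The topology plays no role and is taken to be discrete. *)
Definition dual_group : TopAbGroup := {|
  tg_car := dual G;
  tg_add a b := dual_of_character _
    (character_mult _ _ (ucfun_of_dual_character a) (ucfun_of_dual_character b));
  tg_opp a := dual_of_character _ (character_conj _ (ucfun_of_dual_character a));
  tg_zero := dual_of_character _ character_one;
  tg_open := fun _ => True
|}.

#[export] Instance dual_group_abelian : is_abelian_group dual_group.
Proof.
  split; [|split; [|split]].
  - intros a b c. apply dual_ext. intros x. apply Cmult_assoc.
  - intros a b. apply dual_ext. intros x. apply Cmult_comm.
  - intros a. apply dual_ext. intros x. apply Cmult_1_r.
  - intros a. apply dual_ext. intros x. apply (ucfun_of_dual_character a).
Qed.

Lemma dual_mul_rel_iff (a b c : dual_group) : dual_mul_rel G a b c <-> c = a ⊕ b.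
Proof. split; [intros H; apply dual_ext; exact H|now intros -> x]. Qed.

Lemma dual_is_one_iff (a : dual_group) : dual_is_one G a <-> a = 𝟎.
Proof. split; [intros H; apply dual_ext; exact H|now intros -> x]. Qed.

Lemma dual_group_nsmul n (chi : dual_group) x :
  dual_eval (nsmul dual_group n chi) x = dual_eval chi (nsmul G n x).
Proof.
  induction n as [|n IH]; simpl.
  - symmetry. exact (unitary_character_at_zero _ (ucfun_of_dual_character chi)).
  - transitivity (dual_eval chi x * dual_eval (nsmul dual_group n chi) x)%C; [reflexivity|].
    rewrite IH. symmetry. apply (proj1 (ucfun_of_dual_character chi)).
Qed.

(** * Trigonometric polynomials *)

Lemma trig_eval_linear_factor (c : C) (x : G) p : exists q, forall gam,
  trig_eval G q gam = ((dual_eval gam x - c) * trig_eval G p gam)%C :> C.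
Proof.
  assert (Hcons : forall (a : C) y q gam,
    trig_eval G ((a, y) :: q) gam = (a * dual_eval gam y + trig_eval G q gam)%C :> C)
    by reflexivity.
  exists (flat_map (fun ay : C * G => [(fst ay, snd ay ⊕ x); (- c * fst ay, snd ay)%C]) p).
  intros gam. induction p as [|[a y] p IH].
  - symmetry. apply Cmult_0_r.
  - simpl flat_map. rewrite !Hcons, IH.
    assert (Hm : dual_eval gam (y ⊕ x) = (dual_eval gam y * dual_eval gam x)%C)
      by apply (proj1 (ucfun_of_dual_character gam)).
    rewrite Hm. ring.
Qed.

Lemma trig_eval_vanishing (x : G) (l : list C) : exists p, forall gam,
  trig_eval G p gam = C0 <-> In (dual_eval gam x) l.
Proof.
  induction l as [|c l (p & Hp)].
  - exists [(Defs.C1, 𝟎)]. intros gam. split; [|intros []].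
    intros H.
    assert (Hone : dual_eval gam 𝟎 = 1%C)
      by exact (unitary_character_at_zero _ (ucfun_of_dual_character gam)).
    change (1 * dual_eval gam 𝟎 + 0 = 0)%C in H. rewrite Hone in H.
    apply (f_equal Re) in H. simpl in H. lra.
  - destruct (trig_eval_linear_factor c x p) as (q & Hq). exists q. intros gam.
    specialize (Hp gam). rewrite Hq. split.
    + intros H. destruct (classic (c = dual_eval gam x)) as [Hc|Hc]; [now left|right].
      apply Hp. apply NNPP. intros Hne. revert H. apply Cmult_neq_0; [|exact Hne].
      intros Hsub. apply Hc. now apply Ceq_minus in Hsub.
    + intros [->|H].
      * unfold Cminus. rewrite Cplus_opp_r. apply Cmult_0_l.
      * apply Hp in H. rewrite H. apply Cmult_0_r.
Qed.

End Dual.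

(** * Torsion-free compact groups *)

Lemma nbhs0_nsmul {G : TopAbGroup} {HG : TopologicalGroup G} n (V : G -> Prop) :
  nbhs0 G V -> nbhs0 G (fun x => V (nsmul G n x)).
Proof.
  revert V. induction n as [|n IH]; intros V HV; simpl.
  - apply filter_forall. intros _. now apply nbhs0_zero.
  - destruct (nbhs0_add V HV) as (W & HW & HWV).
    generalize (filter_and _ _ HW (IH W HW)). apply filter_imp. intros x []. auto.
Qed.

Section TorsionFreeCompactGroup.
Context {G : TopAbGroup} {HG : is_compact_abelian_group G}.
Hypothesis Htf : torsion_free G.

Lemma compact_group_hausdorff : hausdorff G.
Proof. apply HG. Qed.

Lemma dual_group_divisible : divisible dual_group.
Proof.
  intros n gam Hn.
  assert (Hembedding : forall V, nbhs0 G V ->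
    exists U, nbhs0 G U /\ forall x, U (nsmul G n x) -> V x).
  { apply compact_injective_embedding; [exact compact_group_hausdorff|apply nsmul_add_r| |].
    - intros x. exact (Htf n x Hn).
    - apply nbhs0_nsmul. }
  destruct (character_extension (nsmul G n) (nsmul_add_r n) (nbhs0_nsmul n) Hembedding
    (ucfun_of_dual gam) (ucfun_of_dual_character gam)) as (chi & Hchi & Hroot).
  exists (dual_of_character chi Hchi). apply dual_ext. intros x.
  rewrite dual_group_nsmul. apply Hroot.
Qed.

Lemma dual_separates a : a <> 𝟎 -> exists chi : dual G, dual_eval chi a <> 1%C.
Proof.
  intros Ha. destruct (hausdorff_nbhs0 a compact_group_hausdorff Ha) as (V & HV & HVa).
  destruct (characters_separate V a HV HVa) as (chi & Hchi & Hne).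
  now exists (dual_of_character chi Hchi).
Qed.

Lemma finite_index_subgroup_full (H : dual G -> Prop) :
  is_subgroup G H -> finite_index G H -> forall gam, H gam.
Proof.
  intros (Hone & Hmul & Hinv) (l & Hl).
  apply (divisible_finite_index_full (D := dual_group) H l).
  - exact dual_group_divisible.
  - now apply Hone, dual_is_one_iff.
  - intros a b Ha Hb. apply (Hmul a (tg_opp dual_group b)); [exact Ha| |now apply dual_mul_rel_iff].
    apply (Hinv b); [exact Hb|]. intros c Hc. apply dual_mul_rel_iff in Hc as ->.
    apply dual_is_one_iff, tg_add_opp_r.
  - intros gam. destruct (Hl gam) as (g & h & Hg & Hh & Hgam). exists g. split; [exact Hg|].
    apply dual_mul_rel_iff in Hgam as ->.
    now rewrite <- tg_add_assoc, tg_add_sub_cancel.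
Qed.

Lemma finite_not_strictly_positive_definite (K : dual G -> Prop) :
  nontrivial G -> finite_subset G K -> ~ strictly_positive_definite G K.
Proof.
  intros (x & Hx) (l & Hl) Hspd.
  destruct (trig_eval_vanishing x (map (fun g => dual_eval g x) l)) as (p & Hp).
  assert (Hvanish : forall gam, trig_eval G p gam = C0).
  { apply Hspd. intros gam Hgam. apply Hp, (in_map (fun g => dual_eval g x)), Hl, Hgam. }
  assert (Hvalues : forall gam, exists g, In g l /\ dual_eval g x = dual_eval gam x).
  { intros gam. pose proof (proj1 (Hp gam) (Hvanish gam)) as Hin.
    apply in_map_iff in Hin as (g & Hg & Hgl). now exists g. }
  destruct (dual_separates x Hx) as (chi & Hchi). apply Hchi.
  apply (divisible_finite_index_full (D := dual_group) (fun gam => dual_eval gam x = 1%C) l).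
  - exact dual_group_divisible.
  - reflexivity.
  - intros a b Ha Hb. change (dual_eval a x * Cconj (dual_eval b x) = 1)%C.
    rewrite Ha, Hb. apply injective_projections; simpl; ring.
  - intros gam. destruct (Hvalues gam) as (g & Hg & Heq). exists g. split; [exact Hg|].
    change (dual_eval gam x * Cconj (dual_eval g x) = 1)%C. rewrite Heq.
    apply (proj2 (ucfun_of_dual_character gam)).
Qed.
End TorsionFreeCompactGroup.

Theorem theorem2p9 (G : TopAbGroup)
  (HG : is_compact_abelian_group G) (Htf : torsion_free G) (Hnt : nontrivial G) :
  (forall K : dual G -> Prop, (exists gam, K gam) -> ubiquitous G K) /\
  (forall K : dual G -> Prop, finite_subset G K -> ~ strictly_positive_definite G K).
Proof.
  split.
  - intros K [c Hc] H HH Hfi gam. exists (tg_add dual_group c (tg_opp dual_group gam)), c.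
    split; [now apply finite_index_subgroup_full|split; [|exact Hc]].
    apply dual_mul_rel_iff. symmetry. apply tg_add_sub_cancel.
  - intros K HK. now apply finite_not_strictly_positive_definite.
Qed.
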